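(* Let $a>b>0$ and consider the magic billiard with flipping over the long axis within the ellipse $\mathcal{E}:\ \frac{x^2}{a}+\frac{y^2}{b}=1$. Consider a trajectory of this billiard with caustic $\mathcal{C}_\beta$. Let $n$ be a positive integer. The trajectory is $n$-periodic if and only if one of the following conditions is satisfied: (i) $n$ is even and $$\left|\begin{array}{cccc} B_3 & B_4 & \dots & B_{n/2+1}\\ B_4 & B_5 & \dots & B_{n/2+2}\\ \dots\\ B_{n/2+1} & B_{n/2+2} & \dots & B_{n-1}\end{array}\right|=0;$$ (ii) $n$ is odd, the caustic is a hyperbola, and $$\left|\begin{array}{cccc} C_2 & C_3 & \dots & C_{(n+1)/2}\\ C_3 & C_4 & \dots & C_{(n+1)/2+1}\\ \dots\\ C_{(n+1)/2} & C_{(n+1)/2+1} & \dots & C_{n-1}\end{array}\right|=0.$$ Here $$\sqrt{(a-x)(b-x)(\beta-x)}=B_0+B_1x+B_2x^2+\dots,\qquad \frac{\sqrt{(a-x)(b-x)(\beta-x)}}{b-x}=C_0+C_1x+C_2x^2+\dots$$ are the Taylor expansions around $x=0$.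
   Context: Confocal family: $\mathcal{C}_\lambda:\ \frac{x^2}{a-\lambda}+\frac{y^2}{b-\lambda}=1$, so $\mathcal{E}=\mathcal{C}_0$; $\mathcal{C}_\lambda$ is an ellipse for $\lambda<b$ and a hyperbola for $b<\lambda<a$. Magic billiard with flipping over the long axis: let $D$ be the closed domain bounded by $\mathcal{E}$, and let $\varphi$ be the reflection of the plane with respect to the longer axis of $\mathcal{E}$, $\varphi(x,y)=(x,-y)$. A particle moves with unit speed along straight segments inside $D$. When it hits $\mathcal{E}$ at a point $A$ with velocity $\vec v$, it continues from the point $\varphi(A)$ with velocity $\varphi^*(\vec v)=d\varphi(\rho_A(\vec v))$, where $\rho_A$ is the usual billiard reflection (reflection of vectors with respect to the tangent line to $\mathcal{E}$ at $A$). Caustic: each trajectory has a unique conic $\mathcal{C}_\beta$ of the confocal family such that the lines containing the segments of the trajectory are all tangent to $\mathcal{C}_\beta$; it is called the caustic of the trajectory. The caustic is nondegenerate, i.e. $\beta\in(0,b)\cup(b,a)$. $n$-periodic: after $n$ consecutive hits at the boundary the particle returns to its initial position and velocity ($n$ is not required to be the minimal such number). The first determinant is of a Hankel matrix of size $n/2-1$, the second of a Hankel matrix of size $(n-1)/2$; an empty ($0\times0$) determinant equals $1$, so the corresponding condition then fails. The branch of the square root is the one positive at $x=0$. *)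

(* Defs.v *)
From mathcomp Require Import all_boot all_order all_algebra.
From mathcomp Require Import all_classical all_reals all_analysis.

Set Implicit Arguments.
Unset Strict Implicit.
Unset Printing Implicit Defensive.

Import Order.TTheory GRing.Theory Num.Theory.
Import numFieldNormedType.Exports.

Local Open Scope classical_set_scope.
Local Open Scope ring_scope.

Section Plane.
Context {R : realType}.
Implicit Types (a b lam beta : R) (u v w A P T : 'rV[R]_2).

Definition xcoord u : R := u ord0 ord0.
Definition ycoord u : R := u ord0 ord_max.
Definition vec2 x y : 'rV[R]_2 := \row_(i < 2) if i == ord0 then x else y.
Definition dot u v : R := xcoord u * xcoord v + ycoord u * ycoord v.

(* a and b are the squares of the semi-axes of C_0. *)
Definition confocal a b lam : set 'rV[R]_2 :=
  [set P | xcoord P ^+ 2 / (a - lam) + ycoord P ^+ 2 / (b - lam) = 1].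

Definition confocal_is_hyperbola a b lam : Prop := b < lam < a.

Definition nondegenerate_caustic a b beta : Prop :=
  0 < beta < b \/ confocal_is_hyperbola a b beta.

(* The polar (bilinear) form of the conic C_lam, in the homogeneous
   coordinates (u : r), where (P : 1) is the affine point P and (v : 0) is
   the point at infinity in the direction v. *)
Definition polar_form a b lam u (r : R) w (s : R) : R :=
  xcoord u * xcoord w / (a - lam) + ycoord u * ycoord w / (b - lam) - r * s.

(* The line through P with direction v touches C_lam at a point of the
   projective plane: it contains a point (T : r) of the conic, and it is the
   polar line of that point.  The points of the line are (r P + s v : r).
   The point of contact may be at infinity (r = 0): the line is then an
   asymptote of a hyperbola.  This case has to be included, since a segment
   through the centre of the ellipse (and not along an axis) lies on an
   asymptote of its hyperbolic caustic. *)
Definition tangent_line a b lam P v : Prop :=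
  exists r s : R, (r, s) != (0, 0) /\
    let T := r *: P + s *: v in
    [/\ polar_form a b lam T r T r = 0,
        polar_form a b lam T r P 1 = 0 &
        polar_form a b lam T r v 0 = 0].

(* Half of the gradient of x^2/a + y^2/b. *)
Definition ellipse_normal a b A : 'rV[R]_2 := vec2 (xcoord A / a) (ycoord A / b).

Definition reflect_at a b A v : 'rV[R]_2 :=
  let N := ellipse_normal a b A in v - (2 * dot v N / dot N N) *: N.

(* The flip is linear, so it is its own differential and acts on positions
   and on velocities by the same formula. *)
Definition flip u : 'rV[R]_2 := vec2 (xcoord u) (- ycoord u).

(* One free flight and one hit: from the boundary point P the particle moves
   with velocity v through the interior of the ellipse until it hits the
   boundary at A; it continues from P' with velocity v'. *)
Definition magic_step a b P v P' v' : Prop :=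
  exists t : R, let A := P + t *: v in
    [/\ 0 < t,
        confocal a b 0 A,
        forall s : R, 0 < s < t ->
          xcoord (P + s *: v) ^+ 2 / a + ycoord (P + s *: v) ^+ 2 / b < 1,
        P' = flip A &
        v' = flip (reflect_at a b A v)].

(* P k and v k are the position and the velocity at the start of the k-th
   segment, i.e. just after the k-th hit and flip. *)
Definition magic_trajectory a b (P v : nat -> 'rV[R]_2) : Prop :=
  forall k, [/\ confocal a b 0 (P k), dot (v k) (v k) = 1 &
                magic_step a b (P k) (v k) (P k.+1) (v k.+1)].

Definition has_caustic a b beta (P v : nat -> 'rV[R]_2) : Prop :=
  forall k, tangent_line a b beta (P k) (v k).

Definition n_periodic n (P v : nat -> 'rV[R]_2) : Prop :=
  P n = P 0%N /\ v n = v 0%N.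

Definition taylor_coef (f : R -> R) k : R := derive1n k f 0 / k`!%:R.

Definition cayley_sqrt a b beta (x : R) : R :=
  Num.sqrt ((a - x) * (b - x) * (beta - x)).

Definition taylor_B a b beta k : R := taylor_coef (cayley_sqrt a b beta) k.

Definition taylor_C a b beta k : R :=
  taylor_coef (fun x => cayley_sqrt a b beta x / (b - x)) k.

Definition hankel (c : nat -> R) (start m : nat) : 'M[R]_m :=
  \matrix_(i < m, j < m) c (start + i + j)%N.

End Plane.

(* Main.v *)
Require Import Defs.
From mathcomp Require Import all_boot all_order all_algebra.
From mathcomp Require Import all_classical all_reals all_analysis.
From mathcomp Require Import ring lra zify.
Set Implicit Arguments.
Unset Strict Implicit.
Unset Printing Implicit Defensive.
Import Order.TTheory GRing.Theory Num.Theory.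
Import numFieldNormedType.Exports.
Local Open Scope ring_scope.

(* Write q_X(u, w) = u_1 w_1 / (a - X) + u_2 w_2 / (b - X).  Along a segment from
   x with velocity v, the polynomials U, V, W obtained from q_X(v, v), q_X(x, v)
   and 1 - q_X(x, x) by multiplication by (a - X)(b - X) are the entries, up to
   sign, of a Lax matrix L with L^2 = V^2 + U W = (a - X)(b - X)(beta - X) =: f.
   A flight followed by a reflection conjugates L by an explicit matrix of degree
   1 in X, which at X = a and X = b moves the coordinates (x_i, v_i) themselves;
   the flip only contributes a sign at X = b.

   If the trajectory is n-periodic, the product T of n such matrices commutes with
   L, so T = A + B L with A^2 - f B^2 = X^(2n), A(a) = a^n and A(b) = (-b)^n.
   Splitting (A - X^n)(A + X^n) = f B^2 into coprime factors gives a Pell equation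
   f2 P^2 - f1 Q^2 = c X^n with f = f1 f2, where f2 = 1 for n even, and f2 = b - X
   for n odd, in which case signs force the caustic to be a hyperbola.  Thus
   Q sqrt(f) / f2 agrees with a polynomial of low degree up to order n, which is
   the vanishing of a Hankel determinant.

   Conversely, a kernel vector Q of the Hankel matrix yields A and B such that
   A + B sqrt(f) vanishes to order 2n at 0.  Then A + B L and T have the same
   kernel to all orders at X = 0 and the same leading term at infinity, so they
   coincide, and the values of A at a and b give periodicity. *)

(** * Lax matrices *)

Section Mx2.
Context {K : comNzRingType}.
Implicit Types (p q r s : K) (M N : 'M[K]_2).

Definition mx2 p q r s : 'M[K]_2 :=
  \matrix_(i, j) if i == 0 then if j == 0 then p else q
                 else if j == 0 then r else s.

Lemma mx2E p q r s :
  ((mx2 p q r s 0 0 = p) * (mx2 p q r s 0 1 = q) *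
   (mx2 p q r s 1 0 = r) * (mx2 p q r s 1 1 = s))%type.
Proof. by rewrite !mxE. Qed.

Lemma mx2_eta M : M = mx2 (M 0 0) (M 0 1) (M 1 0) (M 1 1).
Proof.
apply/matrixP => i j; rewrite mxE.
by case: i => [[|[|//]] ?]; case: j => [[|[|//]] ?]; congr (M _ _); apply: val_inj.
Qed.

Lemma mul_mx2 p q r s p' q' r' s' :
  mx2 p q r s *m mx2 p' q' r' s' =
  mx2 (p * p' + q * r') (p * q' + q * s') (r * p' + s * r') (r * q' + s * s').
Proof.
by rewrite [LHS]mx2_eta; congr mx2; rewrite mxE !big_ord_recl big_ord0 !mxE /= addr0.
Qed.

Lemma scale_mx2 c p q r s :
  c *: mx2 p q r s = mx2 (c * p) (c * q) (c * r) (c * s).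
Proof. by rewrite [LHS]mx2_eta !mxE. Qed.

Lemma add_mx2 p q r s p' q' r' s' :
  mx2 p q r s + mx2 p' q' r' s' = mx2 (p + p') (q + q') (r + r') (s + s').
Proof. by rewrite [LHS]mx2_eta !mxE. Qed.

Lemma opp_mx2 p q r s : - mx2 p q r s = mx2 (- p) (- q) (- r) (- s).
Proof. by rewrite [LHS]mx2_eta !mxE. Qed.

Lemma scalar_mx2 c : c%:M = mx2 c 0 0 c.
Proof. by rewrite [LHS]mx2_eta !mxE. Qed.

Lemma mx2_inj p q r s p' q' r' s' : mx2 p q r s = mx2 p' q' r' s' ->
  [/\ p = p', q = q', r = r' & s = s'].
Proof.
move=> e; have := e; split.
- by have := congr1 (fun M => M 0 0) e; rewrite !mx2E.
- by have := congr1 (fun M => M 0 1) e; rewrite !mx2E.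
- by have := congr1 (fun M => M 1 0) e; rewrite !mx2E.
- by have := congr1 (fun M => M 1 1) e; rewrite !mx2E.
Qed.

Lemma det_mx2 p q r s : \det (mx2 p q r s) = p * s - q * r.
Proof.
rewrite (expand_det_row _ 0) !big_ord_recl big_ord0 /cofactor !det_mx11 !mxE /=.
by rewrite expr0 expr1 mul1r mulN1r mulrN addr0.
Qed.

End Mx2.

Section Lax.
Context {K : comNzRingType}.
Implicit Types (U V W w : K).

(** The signs are chosen so that at X = a and X = b the coordinate pair (x_i, v_i) lies in the
    kernel. *)
Definition lax U V W : 'M[K]_2 := mx2 (- V) (- W) (- U) V.

Lemma lax_sqr U V W : lax U V W *m lax U V W = (V ^+ 2 + U * W)%:M.
Proof. by rewrite scalar_mx2 mul_mx2; congr mx2; ring. Qed.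

End Lax.

Section Step.
Context {F : fieldType}.
Implicit Types (t mu : F) (U V W : {poly F}).

(* X times the map (x_i, v_i) |-> (x_i + t v_i, v_i - mu (x_i + t v_i) / a_i), with
   a_i replaced by X. *)
Definition step_mx t mu : 'M[{poly F}]_2 :=
  mx2 'X (t%:P * 'X) (- mu%:P) ('X - (mu * t)%:P).

(** The adjugate of [step_mx t mu], hence its inverse up to the determinant X^2. *)
Definition step_adj t mu : 'M[{poly F}]_2 :=
  mx2 ('X - (mu * t)%:P) (- (t%:P * 'X)) mu%:P 'X.

Lemma step_mxK t mu : step_mx t mu *m step_adj t mu = ('X^2)%:M.
Proof. by rewrite scalar_mx2 mul_mx2 polyCM; congr mx2; ring. Qed.

Lemma step_adjK t mu : step_adj t mu *m step_mx t mu = ('X^2)%:M.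
Proof. by rewrite scalar_mx2 mul_mx2 polyCM; congr mx2; ring. Qed.

Lemma det_step_mx t mu : \det (step_mx t mu) = 'X^2.
Proof. by rewrite det_mx2 polyCM; ring. Qed.

(* [V + tU] and [W - 2tV - t^2 U] belong to the point of impact; the last two
   hypotheses are the action of the reflection there. *)
Lemma step_lax t mu U V W U' V' W' :
  W' = W - t%:P *+ 2 * V - (t ^+ 2)%:P * U ->
  'X * V' = 'X * (V + t%:P * U) + mu%:P * W' ->
  'X * U' = 'X * U - mu%:P * (V + t%:P * U + V') ->
  step_mx t mu *m lax U V W = lax U' V' W' *m step_mx t mu.
Proof.
move=> eW eV eU; rewrite !mul_mx2 polyCM.
have eU2 : 'X * U = 'X * U' + mu%:P * (V + t%:P * U + V') by rewrite eU; ring.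
have eV2 : mu%:P * W' = 'X * V' - 'X * (V + t%:P * U) by rewrite eV; ring.
have eW2 : W = W' + t%:P *+ 2 * V + (t ^+ 2)%:P * U by rewrite eW; ring.
congr mx2.
- transitivity ('X * - V - t%:P * ('X * U)); first by ring.
  transitivity (- ('X * V') + mu%:P * W'); last by ring.
  by rewrite eV2; ring.
- rewrite eW2 polyC_exp.
  transitivity (- ('X * W') - t%:P * ('X * (V + t%:P * U))); first by ring.
  transitivity (- ('X * W') - t%:P * ('X * V' - mu%:P * W')); last by ring.
  by rewrite eV2; ring.
- transitivity (mu%:P * V - 'X * U + mu%:P * (t%:P * U)); first by ring.
  by rewrite eU2; ring.
- rewrite eW2 polyC_exp.
  transitivity (mu%:P * W' + ('X + mu%:P * t%:P) * V +
    mu%:P * t%:P ^+ 2 * U); first by ring.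
  transitivity ('X * V' - mu%:P * t%:P * V' - t%:P * ('X * U')); last by ring.
  by rewrite eV2 eU; ring.
Qed.

End Step.

Lemma dvdXp {F : fieldType} (p : {poly F}) : ('X %| p) = (p.[0] == 0).
Proof. by rewrite -[X in X %| _]subr0 -(polyC0 F) dvdp_XsubCl. Qed.

Lemma dvdXnP {F : fieldType} m (p : {poly F}) :
  reflect (forall k, (k < m)%N -> p`_k = 0) ('X^m %| p).
Proof.
apply: (iffP idP) => [/dvdpP[q ->] k km|p0]; first by rewrite coefMXn km.
have -> : p = drop_poly m p * 'X^m.
  rewrite -[LHS](poly_take_drop m) [take_poly m p](_ : _ = 0) ?add0r//.
  by apply/polyP => i; rewrite coef_take_poly coef0; case: ifP => // /p0.
exact: dvdp_mulIr.
Qed.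

Section MxDvd.
Context {F : fieldType}.
Implicit Types (d : {poly F}) (M N : 'M[{poly F}]_2).

Definition mxdvd d M := exists Y, M = d *: Y.

Lemma mxdvd_mx2 d p q r s : d %| p -> d %| q -> d %| r -> d %| s ->
  mxdvd d (mx2 p q r s).
Proof.
move=> /dvdpP[p' ->] /dvdpP[q' ->] /dvdpP[r' ->] /dvdpP[s' ->].
by exists (mx2 p' q' r' s'); rewrite scale_mx2 !(mulrC d).
Qed.

Lemma mxdvd_entry d M i j : mxdvd d M -> d %| M i j.
Proof. by case=> Y ->; rewrite mxE dvdp_mulr. Qed.

Lemma mxdvdD d M N : mxdvd d M -> mxdvd d N -> mxdvd d (M + N).
Proof. by case=> Y -> [Z ->]; exists (Y + Z); rewrite scalerDr. Qed.

Lemma mxdvd_mull d M N : mxdvd d N -> mxdvd d (M *m N).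
Proof. by case=> Y ->; exists (M *m Y); rewrite -scalemxAr. Qed.

Lemma mxdvd_scale d (p : {poly F}) M : mxdvd d M -> mxdvd d (p *: M).
Proof. by case=> Y ->; exists (p *: Y); rewrite !scalerA mulrC. Qed.

Lemma mxdvd_scalel d (p : {poly F}) M : d %| p -> mxdvd d (p *: M).
Proof.
by case/dvdpP=> q ->; exists (q *: M); rewrite scalerA mulrC.
Qed.

Lemma mxdvd_coprime d (p : {poly F}) M :
  coprimep d p -> mxdvd d (p *: M) -> mxdvd d M.
Proof.
move=> dp dM; rewrite (mx2_eta M).
by apply: mxdvd_mx2; rewrite -(Gauss_dvdpr _ dp);
  [have := mxdvd_entry 0 0 dM|have := mxdvd_entry 0 1 dM
  |have := mxdvd_entry 1 0 dM|have := mxdvd_entry 1 1 dM]; rewrite mxE.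
Qed.

End MxDvd.

(** * The kernel of a step at X = 0 *)

Section Kernel.
Context {R : realFieldType}.
Implicit Types (t mu : R) (U V W w : {poly R}).

(** Modulo X^2, w is a square root of f, that is, an eigenvalue of the Lax matrix. At X = 0 the
    image of [step_adj t mu] is spanned by (-t, 1), an eigenvector for w; the step relations make
    the match hold to second order. *)
Lemma step_adj_dvd t mu U V W V' W' w :
  t != 0 -> W.[0] = 0 -> w.[0] = - V.[0] -> V'.[0] = V.[0] -> V.[0] != 0 ->
  W' = W - t%:P *+ 2 * V - (t ^+ 2)%:P * U -> W'.[0] = 0 ->
  'X * V' = 'X * (V + t%:P * U) + mu%:P * W' ->
  'X^2 %| V ^+ 2 + U * W - w ^+ 2 ->
  mxdvd 'X^2 ((lax U V W - w%:M) *m step_adj t mu).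
Proof.
move=> t0 W0 w0 V'0 V0 eW W'0 eV fw.
have tU0 : t * U.[0] = - 2 * V.[0].
  have := W'0; rewrite eW !hornerE W0 => e; apply: (mulfI t0); lra.
(* [V1] is V at the point of impact, before the reflection. The line meets the boundary at times 0
   and t, so t U(0) = -2 V(0), and V(0) changes sign during the flight. *)
have [V1 eV1] : {V1 | V1 = V + t%:P * U} by exists (V + t%:P * U).
have /dvdpP[x ew] : 'X %| W' by rewrite dvdXp W'0.
have /dvdpP[y ey] : 'X %| V1 - w.
  by rewrite dvdXp eV1 !hornerE tU0 w0; apply/eqP; lra.
have eV' : V' = V1 + mu%:P * x.
  apply: (mulfI (negbT (polyX_eq0 R))).
  by rewrite eV ew eV1; ring.
have e1 : V1.[0] = - V.[0] by rewrite eV1 !hornerE tU0; lra.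
have mux : mu * x.[0] = 2 * V.[0].
  by move: V'0; rewrite eV' !hornerE e1 => e; lra.
(* The flight preserves V^2 + U W, so [fw] says that X^2 divides V1^2 + U W' - w^2; one factor X is
   taken out. *)
have key : ('X : {poly R}) %| y * (V1 + w) + U * x.
  rewrite -(dvdp_mul2l _ _ (negbT (polyX_eq0 R))) -expr2.
  apply: dvdp_trans fw _; rewrite -[X in X %| _]mul1r.
  have -> : 'X * (y * (V1 + w) + U * x) = V ^+ 2 + U * W - w ^+ 2.
    transitivity (y * 'X * (V1 + w) + U * (x * 'X)); first by ring.
    by rewrite -ey -ew eW eV1 polyC_exp; ring.
  by rewrite mul1r.
have key0 : mu * y.[0] = U.[0].
  move: key; rewrite dvdXp !hornerE e1 w0 => /eqP k.
  apply: (mulfI V0); apply: (mulfI (_ : 2 != 0 :> R)); first by rewrite pnatr_eq0.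
  have : U.[0] * (mu * x.[0]) = 2 * (V.[0] * (mu * y.[0])).
    rewrite mulrCA (_ : U.[0] * x.[0] = 2 * V.[0] * y.[0]); last by lra.
    by ring.
  by rewrite mux => <-; ring.
(* Moving the base point to the impact is a shear; it isolates [W'] and [V1 - w], both multiples of
   X. *)
pose fl : 'M[{poly R}]_2 := mx2 1 (- t%:P) 0 1.
pose N : 'M[{poly R}]_2 := mx2 (- (V1 + w) * 'X - mu%:P * W') (- (W' * 'X))
  (- U * 'X + mu%:P * (V1 - w)) ((V1 - w) * 'X).
have -> : (lax U V W - w%:M) *m step_adj t mu = fl *m N.
  rewrite scalar_mx2 opp_mx2 add_mx2 !mul_mx2 polyCM.
  have -> : W = W' + t%:P *+ 2 * V + (t ^+ 2)%:P * U by rewrite eW; ring.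
  by rewrite eV1 polyC_exp; congr mx2; ring.
apply: mxdvd_mull; apply: mxdvd_mx2.
- have -> : - (V1 + w) * 'X - mu%:P * W' = 'X * - (V1 + w + mu%:P * x).
    by rewrite ew; ring.
  rewrite expr2 dvdp_mul2l ?polyX_eq0// dvdXp !hornerE e1 mux w0.
  by apply/eqP; ring.
- by rewrite ew -mulrA -expr2 dvdpNr dvdp_mulIr.
- have -> : - U * 'X + mu%:P * (V1 - w) = 'X * (- U + mu%:P * y).
    by rewrite ey; ring.
  rewrite expr2 dvdp_mul2l ?polyX_eq0// dvdXp !hornerE key0.
  by apply/eqP; ring.
- by rewrite ey -mulrA -expr2 dvdp_mulIr.
Qed.
End Kernel.

(** * The monodromy matrix *)

Lemma size_mul_bound {F : fieldType} a b (p q : {poly F}) :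
  (size p <= a)%N -> (size q <= b.+1)%N -> (size (p * q)%R <= a + b)%N.
Proof. by move=> pa qb; apply: leq_trans (size_polyMleq _ _) _; lia. Qed.

Lemma size_add_bound {F : fieldType} a (p q : {poly F}) :
  (size p <= a)%N -> (size q <= a)%N -> (size (p + q)%R <= a)%N.
Proof.
by move=> pa qa; apply: leq_trans (size_polyD _ _) _; rewrite geq_max pa.
Qed.

Lemma scalemx_inj {K : idomainType} m n (c : K) (M N : 'M[K]_(m, n)) :
  c != 0 -> c *: M = c *: N -> M = N.
Proof.
move=> c0 /matrixP e; apply/matrixP => i j.
by apply: (mulfI c0); have := e i j; rewrite !mxE.
Qed.

(** * Behaviour at infinity *)

Section Unipotent.
Context {F : fieldType}.
Implicit Types (M N : 'M[{poly F}]_2).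

(** X^-n M tends to an upper unitriangular matrix as X goes to infinity; sizes exceed degrees by
    one. *)
Definition unip_at_infty n M :=
  [/\ (size (M 0 0 - 'X^n)%R <= n)%N, (size (M 0 1)%R <= n.+1)%N,
      (size (M 1 0)%R <= n)%N & (size (M 1 1 - 'X^n)%R <= n)%N].

Lemma unip_at_infty1 : unip_at_infty 0 1%:M.
Proof.
by rewrite scalar_mx2 /unip_at_infty !mx2E subrr size_poly0.
Qed.

Lemma unip_at_inftyM m n M N :
  unip_at_infty m M -> unip_at_infty n N -> unip_at_infty (m + n) (M *m N).
Proof.
rewrite (mx2_eta M) (mx2_eta N) /unip_at_infty mul_mx2 !mx2E.
move: (M 0 0) (M 0 1) (M 1 0) (M 1 1) (N 0 0) (N 0 1) (N 1 0) (N 1 1).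
move=> p q r s p' q' r' s' [hp hq hr hs] [hp' hq' hr' hs'].
have hX k : (size ('X^k : {poly F}) <= k.+1)%N by rewrite size_polyXn.
have top k (u : {poly F}) : (size (u - 'X^k)%R <= k)%N -> (size u <= k.+1)%N.
  by move=> hu; rewrite -(subrK 'X^k u); apply: size_add_bound; [exact: leqW|exact: hX].
have monicM (u u' : {poly F}) : (size (u - 'X^m)%R <= m)%N ->
    (size (u' - 'X^n)%R <= n)%N -> (size (u * u' - 'X^(m + n))%R <= m + n)%N.
  move=> hu hu'; rewrite exprD (_ : u * u' - _ =
    (u - 'X^m) * u' + (u' - 'X^n) * 'X^m); last by ring.
  by apply: size_add_bound; [|rewrite addnC]; apply: size_mul_bound => //; exact: top.
split.
- rewrite addrAC; apply: size_add_bound; first exact: monicM.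
  by rewrite mulrC addnC; exact: size_mul_bound.
- by rewrite -addSn; apply: size_add_bound; apply: size_mul_bound => //; exact: top.
- apply: size_add_bound; first by apply: size_mul_bound => //; exact: top.
  by rewrite mulrC addnC; apply: size_mul_bound => //; exact: top.
- rewrite -addrA; apply: size_add_bound; last exact: monicM.
  exact: size_mul_bound.
Qed.

(** A multiple of X^n vanishes if its degree is below n, and is a constant times X^n if its degree
    is at most n. *)
Lemma unip_at_infty_dvd n M : unip_at_infty n M -> mxdvd 'X^n M ->
  exists c : F, M = 'X^n *: mx2 1 c%:P 0 1.
Proof.
move=> [h00 h01 h10 h11] dM.
have vanish (p : {poly F}) : 'X^n %| p -> (size p <= n)%N -> p = 0.
  move=> dp sp; apply/eqP; apply: contraTT dp => p0; apply: contraTN sp => dp.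
  by rewrite -ltnNge; have := dvdp_leq p0 dp; rewrite size_polyXn.
have /dvdpP[q eq] := mxdvd_entry 0 1 dM.
have sq : (size q <= 1)%N.
  have [->|q0] := eqVneq q 0; first by rewrite size_poly0.
  by move: h01; rewrite eq size_mulXn//; lia.
exists q`_0; rewrite scale_mx2 mulr0 mulr1 -(size1_polyC sq) mulrC -eq.
rewrite [LHS]mx2_eta; congr mx2.
- apply/eqP; rewrite -subr_eq0; apply/eqP/vanish => //.
  by rewrite dvdp_sub// mxdvd_entry.
- by apply: vanish => //; rewrite mxdvd_entry.
- apply/eqP; rewrite -subr_eq0; apply/eqP/vanish => //.
  by rewrite dvdp_sub// mxdvd_entry.
Qed.

End Unipotent.

Section Chain.
Context {R : realFieldType}.
Variables (t mu : nat -> R).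

Fixpoint monodromy n : 'M[{poly R}]_2 :=
  if n is m.+1 then step_mx (t m) (mu m) *m monodromy m else 1%:M.

(** The factors come in reverse order, so this is the adjugate of [monodromy n]. *)
Fixpoint monodromy_adj n : 'M[{poly R}]_2 :=
  if n is m.+1 then monodromy_adj m *m step_adj (t m) (mu m) else 1%:M.

Lemma monodromyK n : monodromy_adj n *m monodromy n = ('X^(2 * n))%:M.
Proof.
elim: n => [|n IH] /=; first by rewrite mulmx1 muln0 expr0.
rewrite mulmxA -(mulmxA (monodromy_adj n)) step_adjK scalar_mxC -mulmxA IH.
by rewrite -scalar_mxM -exprD mulnS.
Qed.

Lemma monodromyVK n : monodromy n *m monodromy_adj n = ('X^(2 * n))%:M.
Proof.
elim: n => [|n IH] /=; first by rewrite mulmx1 muln0 expr0.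
rewrite mulmxA -(mulmxA (step_mx _ _)) IH scalar_mxC -mulmxA step_mxK.
by rewrite -scalar_mxM -exprD mulnS addnC.
Qed.

Lemma det_monodromy n : \det (monodromy n) = 'X^(2 * n).
Proof.
elim: n => [|n IH] /=; first by rewrite det1.
by rewrite det_mulmx IH det_step_mx -exprD mulnS.
Qed.

Lemma unip_monodromy n : unip_at_infty n (monodromy n).
Proof.
elim: n => [|n IH] /=; first exact: unip_at_infty1.
rewrite -add1n; apply: unip_at_inftyM IH.
rewrite /unip_at_infty !mx2E expr1 subrr size_poly0 addrAC subrr sub0r.
rewrite !size_polyN mul_polyC; split=> //; last exact: size_polyC_leq1.
  by apply: leq_trans (size_scale_leq _ _) _; rewrite size_polyX.
exact: size_polyC_leq1.
Qed.

Lemma unip_monodromy_adj n : unip_at_infty n (monodromy_adj n).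
Proof.
elim: n => [|n IH] /=; first exact: unip_at_infty1.
rewrite -addn1; apply: unip_at_inftyM IH _.
rewrite /unip_at_infty !mx2E expr1 subrr size_poly0 addrAC subrr sub0r.
rewrite !size_polyN mul_polyC; split=> //; try exact: size_polyC_leq1.
by apply: leq_trans (size_scale_leq _ _) _; rewrite size_polyX.
Qed.

(** At X = 0 every factor is lower triangular with diagonal 0, - mu t. The trace of the product is
    thus nonzero at 0, which later gives A(0) != 0. *)
Lemma monodromy_at0 n : (forall k, t k != 0) -> (forall k, mu k != 0) ->
  (0 < n)%N -> (monodromy n 0 0).[0] = 0 /\ (monodromy n 1 1).[0] != 0.
Proof.
move=> t0 mu0.
have H m : (monodromy m 0 1).[0] = 0 /\ (monodromy m 1 1).[0] != 0.
  elim: m => [|m [IH1 IH2]] /=; first by rewrite scalar_mx2 !mx2E !hornerE oner_eq0.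
  rewrite (mx2_eta (monodromy m)) mul_mx2 !mx2E !hornerE IH1 !mulr0 !add0r.
  by split=> //; rewrite mulf_neq0// oppr_eq0 mulf_neq0.
case: n => // n _; split; last by case: (H n.+1).
by rewrite /= (mx2_eta (monodromy n)) mul_mx2 !mx2E !hornerE.
Qed.

Section Lax.
Variables (U V W : nat -> {poly R}).
Hypothesis lax_step : forall k,
  step_mx (t k) (mu k) *m lax (U k) (V k) (W k) =
  lax (U k.+1) (V k.+1) (W k.+1) *m step_mx (t k) (mu k).

Let L k := lax (U k) (V k) (W k).

Lemma monodromy_lax n : monodromy n *m L 0 = L n *m monodromy n.
Proof.
elim: n => [|n IH] /=; first by rewrite mulmx1 mul1mx.
by rewrite -mulmxA IH mulmxA lax_step -mulmxA.
Qed.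

Lemma monodromy_adj_lax n : L 0 *m monodromy_adj n = monodromy_adj n *m L n.
Proof.
elim: n => [|n IH] /=; first by rewrite mulmx1 mul1mx.
rewrite mulmxA IH -!mulmxA; congr (_ *m _).
apply: (scalemx_inj (c := 'X^2)); first by rewrite expf_neq0 ?polyX_eq0.
rewrite -!mul_scalar_mx -(step_adjK (t n) (mu n)) -!mulmxA; congr (_ *m _).
rewrite (mulmxA (step_mx _ _) (step_adj _ _)) step_mxK mul_scalar_mx -mul_mx_scalar.
by rewrite -(step_mxK (t n) (mu n)) !mulmxA lax_step.
Qed.

Variables (f w : {poly R}).
Hypotheses (t_neq0 : forall k, t k != 0)
  (laxf : forall k, V k ^+ 2 + U k * W k = f)
  (W_at0 : forall k, (W k).[0] = 0)
  (V_at0 : forall k, (V k).[0] = - w.[0]) (w_at0 : w.[0] != 0)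
  (W_step : forall k, W k.+1 = W k - (t k)%:P *+ 2 * V k - (t k ^+ 2)%:P * U k)
  (V_step : forall k,
     'X * V k.+1 = 'X * (V k + (t k)%:P * U k) + (mu k)%:P * W k.+1).

(* (L - w)^2 = - 2w (L - w) modulo f - w^2, so a product of two such factors
   is divisible by the product of the divisors. *)
Lemma monodromy_adj_dvd n k : 'X^(2 * n) %| f - w ^+ 2 -> (k <= n)%N ->
  mxdvd 'X^(2 * k) ((L 0 - w%:M) *m monodromy_adj k).
Proof.
move=> fw; elim: k => [|k IH] kn.
  by exists ((L 0 - w%:M) *m 1%:M); rewrite muln0 expr0 scale1r.
have [Y eY] := IH (ltnW kn).
have [Z eZ] : mxdvd 'X^2 ((L k - w%:M) *m step_adj (t k) (mu k)).
  apply: (@step_adj_dvd _ _ _ _ _ _ (V k.+1) (W k.+1)) => //;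
    rewrite ?V_at0 ?opprK ?oppr_eq0 ?laxf//.
  by apply: dvdp_trans fw; apply: dvdp_exp2l; lia.
have cop : coprimep 'X^(2 * k.+1) (- 2 *: w).
  rewrite coprimep_expl// coprimepZr ?oppr_eq0 ?pnatr_eq0//.
  rewrite coprimep_sym -[X in coprimep _ X]subr0 -(polyC0 R) coprimep_XsubC.
  by rewrite rootE.
apply: (mxdvd_coprime cop); rewrite /=.
have sq : (- 2 *: w) *: (L 0 - w%:M) =
    (L 0 - w%:M) *m (L 0 - w%:M) - (f - w ^+ 2)%:M.
  rewrite mulmxBl !mulmxBr lax_sqr laxf mul_scalar_mx mul_mx_scalar -scalar_mxM.
  rewrite !(scalar_mx2, opp_mx2, scale_mx2, add_mx2) -!mul_polyC.
  by congr mx2; ring.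
rewrite scalemxAl sq mulmxBl; apply: mxdvdD; last first.
  rewrite mul_scalar_mx -scaleNr; apply: mxdvd_scalel; rewrite dvdpNr.
  by apply: dvdp_trans fw; apply: dvdp_exp2l; lia.
(* One factor L - w is carried through the first k steps to meet the last one; the other stays in
   front for the induction hypothesis. *)
have comm : (L 0 - w%:M) *m monodromy_adj k = monodromy_adj k *m (L k - w%:M).
  by rewrite mulmxBl mulmxBr monodromy_adj_lax mul_scalar_mx mul_mx_scalar.
rewrite -mulmxA (mulmxA _ (monodromy_adj k)) comm -mulmxA eZ mulmxA eY.
exists (Y *m Z); rewrite -scalemxAr -scalemxAl scalerA -exprD; congr ('X^_ *: _).
lia.
Qed.

(* A + B L_0 agrees with the monodromy as soon as A + Bw vanishes to order 2n:
   both have the same kernel at every infinitely near point, so they differ by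
   a constant unipotent factor, which has to preserve the boundary. *)
Lemma monodromy_unique n (A B : {poly R}) :
  'X^(2 * n) %| f - w ^+ 2 -> 'X^(2 * n) %| A + B * w ->
  unip_at_infty n (A%:M + B *: L 0) -> (U 0).[0] != 0 ->
  monodromy n = A%:M + B *: L 0.
Proof.
move=> fw AB uniN U0.
set N := A%:M + B *: L 0.
have [c eS] : exists c : R, N *m monodromy_adj n = 'X^(2 * n) *: mx2 1 c%:P 0 1.
  apply: unip_at_infty_dvd.
    by rewrite mul2n -addnn; apply: unip_at_inftyM => //; exact: unip_monodromy_adj.
  have -> : N = B *: (L 0 - w%:M) + (A + B * w) *: 1%:M.
    rewrite /N !scalar_mx2 !(opp_mx2, scale_mx2, add_mx2).
    by congr mx2; ring.
  rewrite mulmxDl -!scalemxAl; apply: mxdvdD.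
    by apply: mxdvd_scale; exact: monodromy_adj_dvd fw (leqnn n).
  exact: mxdvd_scalel.
have X0 : ('X^(2 * n) : {poly R}) != 0 by rewrite expf_neq0 ?polyX_eq0.
set S : 'M[{poly R}]_2 := mx2 1 c%:P 0 1.
have eN : N = S *m monodromy n.
  apply: (scalemx_inj X0).
  by rewrite scalemxAl -eS -mulmxA monodromyK mul_mx_scalar.
have NL : N *m L 0 = L 0 *m N.
  by rewrite mulmxDl mulmxDr mul_scalar_mx mul_mx_scalar -scalemxAl scalemxAr.
have SL : S *m L n = L 0 *m S.
  apply: (scalemx_inj X0); rewrite -!mul_mx_scalar -(monodromyVK n) !mulmxA.
  by rewrite -(mulmxA S) -monodromy_lax mulmxA -eN NL eN !mulmxA.
suff c0 : c = 0.
  by rewrite -/N eN /S c0 polyC0 (_ : mx2 1 0 0 1 = 1%:M) ?mul1mx// scalar_mx2.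
(* The lower-left entries give U_n = U_0. The upper-left ones at X = 0, where V_n and V_0 agree,
   then give c U_0(0) = 0. *)
move: SL; rewrite /S /L /lax !mul_mx2 => /mx2_inj[e1 _ e2 _].
move: e2; rewrite !(mul0r, mulr0, mulr1, mul1r, add0r, addr0) => /oppr_inj e2.
move: e1; rewrite e2 !(mulr0, mulr1, mul1r, addr0).
move/(congr1 (horner^~ 0)); rewrite !hornerE !V_at0 => e.
by apply/eqP; rewrite -(mulIr_eq0 c (mulIf U0)); apply/eqP; lra.
Qed.

End Lax.
End Chain.

(** * Pell equations and Hankel determinants *)

(** With g = gcd(p, r), p is associate to g^2: squaring a Bezout relation for g gives p | g^2, since
    p | r^2; conversely g is coprime to q, and p q = r^2 then gives g^2 | p. *)
Lemma coprime_factor_sqr {F : fieldType} (p q r : {poly F}) :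
  coprimep p q -> p * q = r ^+ 2 ->
  exists (c : F) (g : {poly F}), c != 0 /\ p = c *: g ^+ 2.
Proof.
move=> pq e; pose g := gcdp p r.
suff /eqpP[[c1 c2] /= /andP[c10 c20] ec] : p %= g ^+ 2.
  exists (c1^-1 * c2), g; split; first by rewrite mulf_neq0 ?invr_eq0.
  by rewrite -scalerA -ec scalerA mulVf// scale1r.
have [r0|r0] := eqVneq r 0.
  rewrite /g r0 gcdp0; move: e; rewrite r0 expr0n /= => /eqP.
  rewrite mulf_eq0 => /orP[/eqP->|/eqP q0]; first by rewrite expr0n eqpxx.
  move: pq; rewrite q0 coprimep0 => p1.
  by apply: (eqp_trans p1); rewrite eqp_sym; have := eqp_exp 2 p1; rewrite expr1n.
have p0 : p != 0.
  by apply: contra_neq r0 => p0; move/esym/eqP: e; rewrite p0 mul0r sqrf_eq0 => /eqP.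
have g0 : g != 0 by rewrite gcdp_eq0 negb_and p0.
apply/andP; split.
  have [[u v] /= uv] := Bezoutp p r.
  rewrite -(eqp_dvdr _ (_ : (u * p + v * r) ^+ 2 %= _)); last first.
    exact: eqp_exp.
  have -> : (u * p + v * r) ^+ 2 = (u ^+ 2 * p + 2 * u * v * r + v ^+ 2 * q) * p.
    transitivity ((u ^+ 2 * p + 2 * u * v * r) * p + v ^+ 2 * r ^+ 2); first by ring.
    by rewrite -e; ring.
  exact: dvdp_mulIr.
have /dvdpP[x ex] : g %| p by exact: dvdp_gcdl.
have /dvdpP[y ey] : g %| r by exact: dvdp_gcdr.
rewrite expr2 [X in _ %| X]ex; apply: dvdp_mul => //.
have gq : coprimep g q by apply: coprimep_dvdr pq; exact: dvdp_gcdl.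
rewrite -(Gauss_dvdpl _ gq).
have -> : x * q = y ^+ 2 * g.
  apply: (mulIf g0); transitivity (x * g * q); first by ring.
  by rewrite -ex e ey; ring.
exact: dvdp_mulIr.
Qed.

Section Pell.
Context {R : rcfType}.
Implicit Types (A B P Q : {poly R}).

(** A - X^n and A + X^n are coprime, since they differ by 2 X^n and A(0) is nonzero. Once f1 and f2
    are removed, their product is B^2. *)
Lemma pell_factor n A B (f1 f2 : {poly R}) : (0 < n)%N ->
  A ^+ 2 - f1 * f2 * B ^+ 2 = 'X^(2 * n) -> A.[0] != 0 ->
  f1 != 0 -> f2 != 0 -> f1 %| A - 'X^n -> f2 %| A + 'X^n ->
  exists (c1 c2 : R) (Q P : {poly R}), [/\ c1 != 0, c2 != 0,
    A - 'X^n = c1 *: (f1 * Q ^+ 2) & A + 'X^n = c2 *: (f2 * P ^+ 2)].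
Proof.
move=> n0 pell A0 f10 f20 /dvdpP[x ex] /dvdpP[y ey].
have cop : coprimep (A - 'X^n) (A + 'X^n).
  rewrite (_ : A + 'X^n = 1 * (A - 'X^n) + 2 *: 'X^n); last first.
    by rewrite -mul_polyC polyC_natr; ring.
  rewrite coprimep_addl_mul coprimepZr ?pnatr_eq0// coprimep_expr//.
  rewrite -[X in coprimep _ X]subr0 -(polyC0 R) coprimep_XsubC rootE !hornerE.
  by rewrite expr0n; case: n n0 {pell ex ey} => // n _; rewrite subr0.
have copxy : coprimep x y.
  apply: (coprimep_dvdr (dvdp_mulIl x f1)); rewrite -ex.
  by apply: (coprimep_dvdl (dvdp_mulIl y f2)); rewrite -ey.
have xy : x * y = B ^+ 2.
  apply: (mulfI (mulf_neq0 f10 f20)).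
  have -> : f1 * f2 * (x * y) = (x * f1) * (y * f2) by ring.
  have -> : f1 * f2 * B ^+ 2 = A ^+ 2 - 'X^(2 * n) by rewrite -pell; ring.
  by rewrite -ex -ey mulnC exprM; ring.
have [c1 [Q [c10 eQ]]] := coprime_factor_sqr copxy xy.
rewrite mulrC in xy; rewrite coprimep_sym in copxy.
have [c2 [P [c20 eP]]] := coprime_factor_sqr copxy xy.
exists c1, c2, Q, P; split=> //.
- by rewrite ex eQ -scalerAl mulrC.
- by rewrite ey eP -scalerAl mulrC.
Qed.

Section Cayley.
(** The degrees of f1 and f2 are s and e, and m is the size of the Hankel matrix. Modulo X^(2n), w
    is a square root of f = f1 f2 and eta is w / f2. Even n uses (s, e) = (3, 0), odd n uses (2,
    1). *)
Variables (n m s e : nat) (f1 f2 w eta : {poly R}).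
Hypotheses (n_gt0 : (0 < n)%N) (en : n = (2 * m + s - 1)%N) (es : (s + e = 3)%N).
Hypotheses (size_f1 : size f1 = s.+1) (size_f2 : size f2 = e.+1).
Hypotheses (f1_0 : 0 < f1.[0]) (f2_0 : 0 < f2.[0]).
Hypotheses (fw : 'X^(2 * n) %| f1 * f2 - w ^+ 2) (eta_w : 'X^(2 * n) %| f2 * eta - w).

Let f1_neq0 : f1 != 0. Proof. by rewrite -size_poly_eq0 size_f1. Qed.
Let f2_neq0 : f2 != 0. Proof. by rewrite -size_poly_eq0 size_f2. Qed.

Let fw_n : 'X^n %| f1 * f2 - w ^+ 2.
Proof. by apply: dvdp_trans fw; apply: dvdp_exp2l; lia. Qed.

Let eta_n : 'X^n %| f2 * eta - w.
Proof. by apply: dvdp_trans eta_w; apply: dvdp_exp2l; lia. Qed.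

Let coprimeX k (p : {poly R}) : p.[0] != 0 -> coprimep 'X^k p.
Proof.
move=> p0; rewrite coprimep_expl// coprimep_sym -[X in coprimep _ X]subr0.
by rewrite -(polyC0 R) coprimep_XsubC rootE.
Qed.

(** Subtracting the two factorizations gives c2 f2 P^2 - c1 f1 Q^2 = 2 X^n. Multiplied by f2, this
    splits modulo X^n into linear factors f2 P - d w Q and f2 P + d w Q. One of them vanishes, so a
    scalar multiple of Q eta agrees with P, whose degree is too low to reach the coefficients in
    question. *)
Lemma cayley_of_pell A B :
  A ^+ 2 - f1 * f2 * B ^+ 2 = 'X^(2 * n) -> A.[0] != 0 ->
  (size (A - 'X^n)%R <= n)%N -> f1 %| A - 'X^n -> f2 %| A + 'X^n ->
  exists Q : {poly R}, [/\ Q != 0, (size Q <= m)%N &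
    forall i, (i < m)%N -> (Q * eta)`_(s + m - 1 + i) = 0].
Proof.
move=> pell A0 sA dA1 dA2.
have [c1 [c2 [Q [P [c10 c20 eQ eP]]]]] :=
  pell_factor n_gt0 pell A0 f1_neq0 f2_neq0 dA1 dA2.
have X0 : 0 ^+ n = 0 :> R by rewrite expr0n eqn0Ngt n_gt0.
have eQ0 : A.[0] = c1 * (f1.[0] * Q.[0] ^+ 2).
  by have := congr1 (horner^~ 0) eQ; rewrite /= !hornerE X0 subr0.
have eP0 : A.[0] = c2 * (f2.[0] * P.[0] ^+ 2).
  by have := congr1 (horner^~ 0) eP; rewrite /= !hornerE X0 addr0.
have Q0 : Q.[0] != 0.
  by apply: contra_neq A0 => Q0; rewrite eQ0 Q0 expr0n /= !mulr0.
have P0 : P.[0] != 0.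
  by apply: contra_neq A0 => P0; rewrite eP0 P0 expr0n /= !mulr0.
have Qn0 : Q != 0 by apply: contra_neq Q0 => ->; rewrite horner0.
have Pn0 : P != 0 by apply: contra_neq P0 => ->; rewrite horner0.
(* The two expressions of A(0) show that c1 / c2 is positive, so it has a real square root. *)
have c12 : 0 < c1 / c2.
  have -> : c1 / c2 = (f2.[0] * P.[0] ^+ 2) / (f1.[0] * Q.[0] ^+ 2).
    apply/eqP; rewrite eqr_div ?mulf_neq0 ?expf_neq0 ?(lt0r_neq0 f1_0)//.
    by rewrite -eQ0 mulrC eP0.
  by apply: divr_gt0; apply: mulr_gt0 => //; rewrite exprn_even_gt0.
pose d := Num.sqrt (c1 / c2); pose D := d *: Q.
have dd : d ^+ 2 * c2 = c1 by rewrite sqr_sqrtr ?ltW// divfK.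
have dvd2 : 'X^n %| (f2 * P - w * D) * (f2 * P + w * D).
  rewrite -(dvdpZr _ _ c20).
  have -> : c2 *: ((f2 * P - w * D) * (f2 * P + w * D)) =
      f2 * (2 *: 'X^n) + c1 *: (Q ^+ 2 * (f1 * f2 - w ^+ 2)).
    have -> : 2 *: 'X^n = c2 *: (f2 * P ^+ 2) - c1 *: (f1 * Q ^+ 2).
      by rewrite -eP -eQ -mul_polyC polyC_natr; ring.
    by rewrite /D -!mul_polyC -dd polyCM polyC_exp; ring.
  rewrite dvdp_add//; first by rewrite dvdp_mull// dvdpZr ?pnatr_eq0.
  by rewrite dvdpZr// dvdp_mull.
(* The two factors do not both vanish at 0, since their sum there is 2 f2(0) P(0); a factor that
   does not vanish is a unit modulo X^n. [D'] absorbs the sign. *)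
have [D' [eD' D'0]] : exists D', 'X^n %| f2 * P - w * D' /\
    (exists2 d', d' != 0 & D' = d' *: Q).
  have d0 : d != 0 by rewrite lt0r_neq0// sqrtr_gt0.
  have [h|h] := eqVneq (f2 * P + w * D).[0] 0.
    exists (- D); split; last first.
      by exists (- d); rewrite ?oppr_eq0// scaleNr.
    rewrite mulrN opprK -(Gauss_dvdpr _ (coprimeX n (_ : (f2 * P - w * D).[0] != 0)))//.
    move: h; rewrite !hornerE => h; apply: contra_neq P0 => h'.
    have : 2 * f2.[0] * P.[0] = 0 by lra.
    by move/eqP; rewrite !mulf_eq0 pnatr_eq0 (gt_eqF f2_0) /= => /eqP.
  exists D; split; last by exists d.
  by rewrite -(Gauss_dvdpl _ (coprimeX n h)).
case: D'0 => d' d'0 eD; exists Q; split=> //.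
  have : (size (c1 *: (f1 * Q ^+ 2))%R <= n)%N by rewrite -eQ.
  rewrite size_scale// expr2 !size_mul ?mulf_neq0// size_f1.
  by have := size_poly_gt0 Q; rewrite Qn0; move: (size Q) en es; clear; lia.
have sP : (size P <= s + m - 1)%N.
  have : (size (c2 *: (f2 * P ^+ 2))%R <= n.+1)%N.
    rewrite -eP (_ : A + _ = A - 'X^n + 2 *: 'X^n); last first.
      by rewrite -mul_polyC polyC_natr; ring.
    apply: size_add_bound; first exact: leqW.
    by rewrite size_scale ?pnatr_eq0// size_polyXn.
  rewrite size_scale// expr2 !size_mul ?mulf_neq0// size_f2.
  by have := size_poly_gt0 P; rewrite Pn0; move: (size P) en es; clear; lia.
have : 'X^n %| P - eta * D'.
  rewrite -(Gauss_dvdpr _ (coprimeX n (lt0r_neq0 f2_0))).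
  have -> : f2 * (P - eta * D') = (f2 * P - w * D') - (f2 * eta - w) * D' by ring.
  by apply: dvdp_sub => //; apply: dvdp_mulr.
(* The indices from s + m - 1 to n - 1 are exactly m in number. *)
move/dvdXnP => van i im; apply: (mulfI d'0); rewrite mulr0 -coefZ scalerAl -eD.
have := van (s + m - 1 + i)%N; rewrite coefB nth_default; last first.
  by apply: leq_trans sP _; rewrite leq_addr.
rewrite sub0r (mulrC D') => h; apply: oppr_inj; rewrite oppr0 h//.
by move: im en es; clear; lia.
Qed.

(** With P the truncation of Q eta, f2 P^2 - f1 Q^2 is divisible by X^n and has degree at most n, so
    it is c X^n. Up to a unit, A + B w is then the square of f2 P - Q w modulo X^(2n), which doubles
    the order of vanishing. *)
Lemma pell_of_cayley Q : Q != 0 -> (size Q <= m)%N ->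
  (forall i, (i < m)%N -> (Q * eta)`_(s + m - 1 + i) = 0) ->
  exists A B : {poly R}, [/\ 'X^(2 * n) %| A + B * w, (size (A - 'X^n)%R <= n)%N,
    (size B <= n.-1)%N, f1 %| A - 'X^n & f2 %| A + 'X^n].
Proof.
move=> Qn0 sQ kerQ; pose P := take_poly (s + m - 1) (Q * eta).
have m_gt0 : (0 < m)%N by apply: leq_trans sQ; rewrite size_poly_gt0.
have sP : (size P <= s + m - 1)%N by exact: size_take_poly.
have dP : 'X^n %| P - Q * eta.
  apply/dvdXnP => k kn; rewrite coefB coef_take_poly; case: ltnP => km.
    by rewrite subrr.
  rewrite sub0r -(subnKC km) kerQ ?oppr0//.
  by move: kn km m_gt0 en; clear; lia.
have f2P : 'X^n %| f2 * P - Q * w.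
  have -> : f2 * P - Q * w = f2 * (P - Q * eta) + Q * (f2 * eta - w) by ring.
  by apply: dvdp_add; apply: dvdp_mull.
have sq2 : 'X^(2 * n) %| (f2 * P - Q * w) ^+ 2.
  by rewrite mulnC exprM; exact: dvdp_exp2r.
pose E := f2 * P ^+ 2 - f1 * Q ^+ 2.
have dE : 'X^n %| E.
  rewrite -(Gauss_dvdpr _ (coprimeX n (lt0r_neq0 f2_0))).
  have -> : f2 * E = (f2 * P - Q * w) * (f2 * P + Q * w) -
      Q ^+ 2 * (f1 * f2 - w ^+ 2) by rewrite /E; ring.
  by apply: dvdp_sub; [apply: dvdp_mulr|apply: dvdp_mull].
have sPP : (size (f2 * P ^+ 2)%R <= n.+1)%N.
  rewrite mulrC expr2 -mulrA.
  have sPf : (size (P * f2)%R <= s + m - 1 + e)%N.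
    by apply: size_mul_bound; rewrite ?size_f2.
  apply: leq_trans (size_polyMleq _ _) _.
  by move: (size P) (size (P * f2)) sP sPf en es m_gt0; clear; lia.
have sQQ : (size (f1 * Q ^+ 2)%R <= n)%N.
  rewrite expr2 !size_mul ?mulf_neq0// size_f1.
  by have := size_poly_gt0 Q; rewrite Qn0; move: (size Q) sQ en es; clear; lia.
have [c ec] : exists c, E = c *: 'X^n.
  have /dvdpP[q eq] := dE.
  have sE : (size E <= n.+1)%N.
    by apply: size_add_bound => //; rewrite size_polyN; exact: leqW.
  have sq : (size q <= 1)%N.
    have [->|q0] := eqVneq q 0; first by rewrite size_poly0.
    by move: sE; rewrite eq size_mulXn// -addn1 leq_add2l.
  by exists q`_0; rewrite eq -mul_polyC -(size1_polyC sq).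
(* For c = 0 the equal polynomials f2 P^2 and f1 Q^2 would have degrees of opposite parity, as s + e
   = 3. *)
have c0 : c != 0.
  apply/eqP => c0; move/eqP: ec; rewrite c0 scale0r subr_eq0 => /eqP ee.
  have P0 : P != 0.
    apply: contra_neq (mulf_neq0 f1_neq0 (expf_neq0 2 Qn0)) => P0.
    by rewrite -ee P0 expr0n mulr0.
  have := congr1 (fun p : {poly R} => size p) ee.
  rewrite !expr2 !size_mul ?mulf_neq0// size_f1 size_f2.
  have := size_poly_gt0 P; have := size_poly_gt0 Q; rewrite P0 Qn0.
  by move: (size P) (size Q) es; clear; lia.
have eP : f2 * P ^+ 2 = f1 * Q ^+ 2 + c *: 'X^n by rewrite -ec /E; ring.
(* A solves A - X^n = (2/c) f1 Q^2 and A + X^n = (2/c) f2 P^2 together, and B is the matching root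
   of A^2 - f B^2 = X^(2n). *)
exists ('X^n + (2 / c) *: (f1 * Q ^+ 2)), (- (2 / c) *: (P * Q)).
have eA : 'X^n + (2 / c) *: (f1 * Q ^+ 2) + 'X^n = (2 / c) *: (f2 * P ^+ 2).
  rewrite eP scalerDr scalerA divfK// -(mul_polyC 2) polyC_natr; ring.
split.
- rewrite -(Gauss_dvdpr _ (coprimeX _ (lt0r_neq0 f2_0))).
  rewrite -(dvdpZr _ _ c0).
  have -> : c *: (f2 * ('X^n + (2 / c) *: (f1 * Q ^+ 2) +
      - (2 / c) *: (P * Q) * w)) =
      (f2 * P - Q * w) ^+ 2 + Q ^+ 2 * (f1 * f2 - w ^+ 2).
    have -> : c *: (f2 * ('X^n + (2 / c) *: (f1 * Q ^+ 2) +
      - (2 / c) *: (P * Q) * w)) = f2 * (c *: 'X^n +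
      (c * (2 / c)) *: (f1 * Q ^+ 2 - P * Q * w)).
      by rewrite -!mul_polyC polyCM polyCN; ring.
    rewrite (mulrC c) divfK//.
    rewrite -ec /E -(mul_polyC 2) polyC_natr; ring.
  by rewrite dvdp_add// dvdp_mull.
- rewrite addrC addKr; exact: leq_trans (size_scale_leq _ _) _.
- apply: leq_trans (size_scale_leq _ _) _; apply: leq_trans (size_polyMleq _ _) _.
  by move: (size P) (size Q) sP sQ en es; clear; lia.
- by rewrite addrC addKr dvdpZr ?dvdp_mulr// mulf_neq0 ?invr_eq0 ?pnatr_eq0.
- by rewrite eA dvdpZr ?dvdp_mulr// mulf_neq0 ?invr_eq0 ?pnatr_eq0.
Qed.

End Cayley.
End Pell.

(** * Hankel determinants as linear conditions on a polynomial *)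

Section Hankel.
Context {R : realType}.

Lemma coef_mul_small (p q : {poly R}) m k : (size p <= m)%N -> (m <= k.+1)%N ->
  (p * q)`_k = \sum_(j < m) p`_j * q`_(k - j).
Proof.
move=> pm mk; rewrite coefM (big_ord_widen _ (fun j => p`_j * q`_(k - j)) mk).
rewrite [LHS](bigID (fun j : 'I_k.+1 => (j < m)%N)) /= [X in _ + X]big1 ?addr0//.
by move=> j; rewrite -leqNgt => mj; rewrite nth_default ?mul0r// (leq_trans pm).
Qed.

(** A kernel vector read backwards is the coefficient list of Q: reversing the summation index turns
    the convolution of index s + m - 1 + i into the i-th Hankel equation. For m = 0 both sides fail:
    the empty determinant is 1 and no nonzero Q has size 0. *)
Lemma hankel_det_eq0 (c : nat -> R) s m (p : {poly R}) : (0 < s)%N ->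
  (forall k, (k < s + 2 * m - 1)%N -> p`_k = c k) ->
  \det (hankel c s m) = 0 <->
  exists Q : {poly R}, [/\ Q != 0, (size Q <= m)%N &
    forall i, (i < m)%N -> (Q * p)`_(s + m - 1 + i) = 0].
Proof.
move=> s0 pc.
pose rev (v : 'rV[R]_m) : 'rV[R]_m := \row_j v 0 (rev_ord j).
have revK : involutive rev by move=> v; apply/rowP => j; rewrite !mxE rev_ordK.
have E (v : 'rV[R]_m) (i : 'I_m) :
    (rVpoly (rev v) * p)`_(s + m - 1 + i) = (v *m hankel c s m) 0 i.
  rewrite (@coef_mul_small _ _ m) ?size_poly//; last first.
    by move: (i : nat) s0; clear; lia.
  rewrite mxE (reindex_inj rev_ord_inj); apply: eq_bigr => j _.
  rewrite coef_rVpoly_ord !mxE rev_ordK /=; congr (_ * _).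
  have jm := ltn_ord j; have im := ltn_ord i.
  rewrite pc; first by congr c; move: (i : nat) (j : nat) jm im s0; clear; lia.
  by move: (i : nat) (j : nat) jm im s0; clear; lia.
split=> [/eqP/det0P[v v0 vH]|[Q [Q0 sQ kerQ]]].
  exists (rVpoly (rev v)); split; first 1 last.
  - exact: size_poly.
  - by move=> i im; rewrite (E v (Ordinal im)) vH mxE.
  apply: contra_neq v0 => r0; rewrite -(revK v) -[rev v]rVpolyK r0 linear0.
  by apply/rowP => j; rewrite !mxE.
apply/eqP/det0P; exists (rev (poly_rV Q)).
  apply: contra_neq Q0 => q0; rewrite -(poly_rV_K sQ) -(revK (poly_rV Q)) q0.
  by apply/polyP => j; rewrite coef_rVpoly coef0; case: insubP => // k _ _; rewrite !mxE.
apply/rowP => i; rewrite -E revK poly_rV_K// kerQ// mxE//.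
Qed.

End Hankel.

(** * Taylor polynomials *)

(** Pascal's rule, as used in the induction for the Leibniz formula; F i j stands for a product of
    an i-th and a j-th derivative. *)
Lemma sum_binS {R : nzRingType} (F : nat -> nat -> R) n :
  \sum_(i < n.+1) 'C(n, i)%:R * (F i.+1 (n - i)%N + F i (n.+1 - i)%N) =
  \sum_(i < n.+2) 'C(n.+1, i)%:R * F i (n.+1 - i)%N.
Proof.
under eq_bigr do rewrite mulrDr.
rewrite big_split /= [RHS]big_ord_recl [X in X + _]big_ord_recr /=.
rewrite [X in _ + X]big_ord_recl [in RHS]big_ord_recr /=.
rewrite !bin0 !binn !subnn.
under [X in _ = _ + (X + _)]eq_bigr => i _ do
  rewrite /bump /= add1n binS natrD mulrDl subSS.
rewrite big_split /=.
under [X in _ + (_ + X) = _]eq_bigr => i _ do rewrite /bump /= add1n subSS.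
by rewrite /bump /= add1n [LHS]addrC !addrA.
Qed.

Section Taylor.
Context {R : realType}.
Implicit Types (f g h : R -> R) (D : set R).

(** [derive1n] has a value even where no derivative exists, so derivability is demanded at each
    order. *)
Definition smooth_on D f := forall k x, D x -> derivable (derive1n k f) x 1.

Lemma near_open_set D x : open D -> D x -> \forall y \near x, D y.
Proof. by move=> Dopen Dx; apply: open_nbhs_nbhs; split. Qed.

Lemma eq_derive1n D f g : open D -> (forall x, D x -> f x = g x) ->
  forall k x, D x -> derive1n k f x = derive1n k g x.
Proof.
move=> Dopen fg; elim=> [|k IH] x Dx; first exact: fg.
rewrite !derive1nS !derive1E; apply: near_eq_derive.
by apply: filterS (near_open_set Dopen Dx) => y /IH.
Qed.

Lemma leibniz D f g : open D -> smooth_on D f -> smooth_on D g ->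
  forall n x, D x -> derive1n n (fun y => f y * g y) x =
    \sum_(i < n.+1) 'C(n, i)%:R * (derive1n i f x * derive1n (n - i) g x).
Proof.
move=> Dopen sf sg; elim=> [|n IH] x Dx.
  by rewrite big_ord_recl big_ord0 bin0 addr0 mul1r.
rewrite derive1nS derive1E.
pose S i y := 'C(n, i)%:R * (derive1n i f y * derive1n (n - i) g y).
have dS (i : 'I_n.+1) : is_derive x 1 (S i) ('C(n, i)%:R *
   (derive1n i.+1 f x * derive1n (n - i) g x +
    derive1n i f x * derive1n (n.+1 - i) g x)).
  have df := derivableP (sf i x Dx); have dg := derivableP (sg (n - i)%N x Dx).
  have -> : S i = 'C(n, i)%:R \*: ((derive1n i f : R -> R^o) * derive1n (n - i) g).
    by [].
  apply: is_derive_eq.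
  rewrite subSn -1?ltnS// !derive1nS !derive1E /GRing.scale /=.
  by ring.
rewrite (near_eq_derive (g := \sum_(i < n.+1) S i)); last first.
  apply: filterS (near_open_set Dopen Dx) => y Dy.
  by rewrite IH// fct_sumE.
rewrite derive_val.
exact: (sum_binS (fun i j => derive1n i f x * derive1n j g x)).
Qed.

Definition taylor_poly f n : {poly R} := \poly_(k < n) taylor_coef f k.

(** Divided by k!, the Leibniz formula is the Cauchy product. *)
Lemma taylor_polyM D f g h n : open D -> D 0 -> smooth_on D f -> smooth_on D g ->
  (forall x, D x -> f x * g x = h x) ->
  'X^n %| taylor_poly f n * taylor_poly g n - taylor_poly h n.
Proof.
move=> Dopen D0 sf sg fgh; apply/dvdXnP => k kn.
rewrite coefB coef_poly kn coefM /taylor_coef.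
rewrite -(eq_derive1n Dopen fgh k D0) (leibniz Dopen sf sg)// mulr_suml.
apply/eqP; rewrite subr_eq0; apply/eqP/eq_bigr => i _.
have ik : (i <= k)%N by rewrite -ltnS.
rewrite !coef_poly (leq_ltn_trans ik kn) (leq_ltn_trans (leq_subr _ _) kn).
rewrite /taylor_coef -(bin_fact ik) !natrM; field.
by rewrite !pnatr_eq0 -!lt0n !fact_gt0 bin_gt0.
Qed.

Lemma derive1n_horner (p : {poly R}) k : derive1n k (horner p) = horner p^`(k).
Proof.
elim: k => [|k IH]; first by rewrite derivn0.
by rewrite derive1nS IH -derivE derivnS.
Qed.

Lemma smooth_horner D (p : {poly R}) : smooth_on D (horner p).
Proof. by move=> k x _; rewrite derive1n_horner; exact: derivable_horner. Qed.

Lemma taylor_poly_horner (p : {poly R}) n : 'X^n %| taylor_poly (horner p) n - p.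
Proof.
apply/dvdXnP => k kn; rewrite coefB coef_poly kn /taylor_coef derive1n_horner.
by rewrite horner_coef0 coef_derivn addn0 ffactnn -(mulr_natr p`_k) mulfK ?subrr//.
Qed.

(* The functions [p sqrt(F) / F^k] are stable under differentiation. *)
Lemma derive_sqrt_class (F p : {poly R}) k x : 0 < F.[x] ->
  is_derive x 1 (fun y => p.[y] * Num.sqrt F.[y] / F.[y] ^+ k)
    ((p^`() * F + 2^-1 *: (p * F^`()) - k%:R *: (p * F^`())).[x]
      * Num.sqrt F.[x] / F.[x] ^+ k.+1).
Proof.
move=> Fx.
have F0 : F.[x] != 0 by rewrite gt_eqF.
have dF : is_derive x 1 (horner F) F^`().[x] by exact: is_derive_poly.
have dp : is_derive x 1 (horner p) p^`().[x] by exact: is_derive_poly.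
have dS : is_derive x 1 (Num.sqrt \o horner F)
    ((2 * Num.sqrt F.[x])^-1 * F^`().[x]).
  by apply: is_derive1_comp; exact: is_derive1_sqrt.
have dV : is_derive x 1 (fun y => (((horner F : R -> R) ^+ k) y)^-1)
    (- (((horner F : R -> R) ^+ k) x) ^- 2 *: ((k%:R * F.[x] ^+ k.-1) *: F^`().[x])).
  by apply: is_deriveV; rewrite /= ?exprfctE ?expf_neq0.
have -> : (fun y => p.[y] * Num.sqrt F.[y] / F.[y] ^+ k) =
    ((horner p * (Num.sqrt \o horner F) : R -> R) *
     (fun y => (((horner F : R -> R) ^+ k) y)^-1)).
  by apply/funext => y; rewrite /= exprfctE.
apply: is_derive_eq; rewrite !exprfctE /GRing.scale /= !hornerE.
rewrite -[(horner p * _) x]/(p.[x] * Num.sqrt F.[x]).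
have s0 : Num.sqrt F.[x] != 0 by rewrite gt_eqF// sqrtr_gt0.
have sF : Num.sqrt F.[x] ^+ 2 = F.[x] by rewrite sqr_sqrtr ?ltW.
move: (Num.sqrt F.[x]) s0 sF => s s0 sF.
move: F0; rewrite -sF => F0.
case: k dV => [|k] _; rewrite /= ?expr0.
  by field.
rewrite !(exprS (s ^+ 2)).
by field; rewrite s0 expf_neq0.
Qed.

Lemma open_horner_gt0 (F : {poly R}) : open [set x | 0 < F.[x]]%classic.
Proof.
have := open_comp (D := [set x : R | 0 < x]%classic) (f := horner F).
by apply=> [y _|]; [exact: continuous_horner|exact: open_gt].
Qed.

Lemma smooth_sqrt_class (F p : {poly R}) k :
  smooth_on [set x | 0 < F.[x]]%classic
    (fun y => p.[y] * Num.sqrt F.[y] / F.[y] ^+ k).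
Proof.
set D := [set x | _]%classic; have Dopen : open D by exact: open_horner_gt0.
suff H m : exists q l, forall x, D x ->
    derive1n m (fun y => p.[y] * Num.sqrt F.[y] / F.[y] ^+ k) x =
    q.[x] * Num.sqrt F.[x] / F.[x] ^+ l.
  move=> m x Dx; have [q [l e]] := H m.
  have [] := derive_sqrt_class q l Dx; move=> d _; apply: near_eq_derivable d.
  by apply: filterS (near_open_set Dopen Dx) => y /e.
elim: m => [|m [q [l IH]]]; first by exists p, k.
exists (q^`() * F + 2^-1 *: (q * F^`()) - l%:R *: (q * F^`())), l.+1 => x Dx.
rewrite derive1nS derive1E; have [_ <-] := derive_sqrt_class q l Dx.
apply: near_eq_derive.
by apply: filterS (near_open_set Dopen Dx) => y /IH.
Qed.

End Taylor.

(** * Taylor expansions of the two functions in Cayley's conditions *)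

Section TaylorCayley.
Context {R : realType}.
Variables (a b beta : R).
Hypotheses (a0 : 0 < a) (b0 : 0 < b) (beta0 : 0 < beta).

Definition cayley_cubic : {poly R} :=
  (a%:P - 'X) * (b%:P - 'X) * (beta%:P - 'X).

Let F := cayley_cubic.
Let D := [set x | 0 < F.[x]]%classic.

Let FE x : F.[x] = (a - x) * (b - x) * (beta - x).
Proof. by rewrite !hornerE. Qed.

Let D0 : D 0. Proof. by rewrite /D /= FE !subr0 !mulr_gt0. Qed.

Let Dopen : open D. Proof. exact: open_horner_gt0. Qed.

Let smooth_sqrt : smooth_on D (cayley_sqrt a b beta).
Proof.
have := @smooth_sqrt_class _ F 1 0.
by congr smooth_on; apply/funext => x; rewrite expr0 divr1 hornerE mul1r FE.
Qed.

Let bx_neq0 x : D x -> b - x != 0.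
Proof.
rewrite /D /= FE => Dx; apply: contraTneq Dx => ->.
by rewrite mulr0 mul0r ltxx.
Qed.

Let smooth_sqrt_div : smooth_on D (fun x => cayley_sqrt a b beta x / (b - x)).
Proof.
move=> k x Dx.
(* Writing 1 / (b - x) as (a - x)(beta - x) / F(x) brings the quotient into the class p sqrt(F) /
   F^k with k = 1. *)
have := @smooth_sqrt_class _ F ((a%:P - 'X) * (beta%:P - 'X)) 1 k x Dx.
apply: near_eq_derivable.
apply: filterS (near_open_set Dopen Dx); apply: eq_derive1n => // y Dy.
have b_y := bx_neq0 Dy; have F0 : F.[y] != 0 by rewrite gt_eqF.
rewrite /cayley_sqrt -FE expr1; move: F0; rewrite {1 3}FE !hornerE => F0.
move: (Num.sqrt _) => s; field.
by move: F0; rewrite !mulf_eq0 !negb_or -andbA => /and3P[-> -> ->].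
Qed.

Definition taylor_B_poly n := taylor_poly (cayley_sqrt a b beta) n.
Definition taylor_C_poly n :=
  taylor_poly (fun x => cayley_sqrt a b beta x / (b - x)) n.

Lemma taylor_B_sqr n : 'X^n %| cayley_cubic - taylor_B_poly n ^+ 2.
Proof.
have h : 'X^n %| taylor_B_poly n * taylor_B_poly n - taylor_poly (horner F) n.
  apply: taylor_polyM Dopen D0 smooth_sqrt smooth_sqrt _ => x Dx.
  by rewrite -expr2 sqr_sqrtr ?FE// ltW// -FE.
have -> : cayley_cubic - taylor_B_poly n ^+ 2 = - (taylor_B_poly n * taylor_B_poly n -
  taylor_poly (horner F) n) - (taylor_poly (horner F) n - F) by rewrite /F; ring.
by apply: dvdp_sub; [rewrite dvdpNr|exact: taylor_poly_horner].
Qed.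

Lemma taylor_C_mul n : 'X^n %| (b%:P - 'X) * taylor_C_poly n - taylor_B_poly n.
Proof.
have h : 'X^n %| taylor_poly (horner (b%:P - 'X)) n * taylor_C_poly n - taylor_B_poly n.
  apply: taylor_polyM Dopen D0 (@smooth_horner _ D (b%:P - 'X)) smooth_sqrt_div _ => x Dx.
  by rewrite hornerD hornerN hornerX hornerC mulrC divfK// bx_neq0.
have -> : (b%:P - 'X) * taylor_C_poly n - taylor_B_poly n =
  (taylor_poly (horner (b%:P - 'X)) n * taylor_C_poly n - taylor_B_poly n) -
  (taylor_poly (horner (b%:P - 'X)) n - (b%:P - 'X)) * taylor_C_poly n by ring.
by apply: dvdp_sub => //; apply: dvdp_mulr; exact: taylor_poly_horner.
Qed.

Lemma taylor_B_poly0 n : (0 < n)%N ->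
  0 < (taylor_B_poly n).[0] /\ (taylor_B_poly n).[0] ^+ 2 = a * b * beta.
Proof.
move=> n0; rewrite horner_coef0 coef_poly n0 /taylor_coef derive1n0 fact0 divr1.
rewrite /cayley_sqrt !subr0 sqrtr_gt0 sqr_sqrtr; last by rewrite ltW// !mulr_gt0.
by rewrite !mulr_gt0.
Qed.

End TaylorCayley.

(** * The billiard map *)

(** Used with c = d = a for the abscissas, and with c = b, d = -b for the ordinates, where the sign
    is that of the flip. *)
Lemma monodromy_eval {R : realFieldType} (t mu : nat -> R) (c d : R)
    (z u : nat -> R) :
  (forall k, c * (z k + t k * u k) = d * z k.+1) ->
  (forall k, c * u k - mu k * (z k + t k * u k) = d * u k.+1) ->
  forall n,
    (monodromy t mu n 0 0).[c] * z 0 + (monodromy t mu n 0 1).[c] * u 0 = d ^+ n * z n /\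
    (monodromy t mu n 1 0).[c] * z 0 + (monodromy t mu n 1 1).[c] * u 0 = d ^+ n * u n.
Proof.
move=> hz hu; elim=> [|n [IH1 IH2]] /=.
  by rewrite scalar_mx2 !mx2E !hornerE.
rewrite (mx2_eta (monodromy t mu n)) mul_mx2 !mx2E !hornerE !exprSr -!mulrA -hz -hu.
set p := (monodromy _ _ _ _ _).[c] in IH1 *; set q := (monodromy _ _ _ 0 1).[c] in IH1 *.
set r := (monodromy _ _ _ 1 0).[c] in IH2 *; set s := (monodromy _ _ _ 1 1).[c] in IH2 *.
split.
  transitivity (c * (p * z 0 + q * u 0) + c * t n * (r * z 0 + s * u 0)); first by ring.
  by rewrite IH1 IH2; ring.
transitivity (- mu n * (p * z 0 + q * u 0) + (c - mu n * t n) * (r * z 0 + s * u 0)).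
  by ring.
by rewrite IH1 IH2; ring.
Qed.

Lemma size_CsubX {F : fieldType} (c : F) : size (c%:P - 'X) = 2.
Proof. by rewrite -opprB size_polyN size_XsubC. Qed.

Section LaxPolynomials.
Context {R : realType}.
Variables (a b : R).
Implicit Types (P v : 'rV[R]_2).

Definition lax_U v : {poly R} :=
  (xcoord v)%:P ^+ 2 * (b%:P - 'X) + (ycoord v)%:P ^+ 2 * (a%:P - 'X).
Definition lax_V P v : {poly R} :=
  (xcoord P)%:P * (xcoord v)%:P * (b%:P - 'X) +
  (ycoord P)%:P * (ycoord v)%:P * (a%:P - 'X).
Definition lax_W P : {poly R} :=
  (a%:P - 'X) * (b%:P - 'X) - (xcoord P)%:P ^+ 2 * (b%:P - 'X) -
  (ycoord P)%:P ^+ 2 * (a%:P - 'X).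

Lemma size_lax_U v : dot v v = 1 -> size (lax_U v) = 2.
Proof.
move=> v1; rewrite /lax_U.
have -> : (xcoord v)%:P ^+ 2 * (b%:P - 'X) + (ycoord v)%:P ^+ 2 * (a%:P - 'X) =
   - ('X - (xcoord v ^+ 2 * b + ycoord v ^+ 2 * a)%:P).
  have : (xcoord v)%:P ^+ 2 + (ycoord v)%:P ^+ 2 = 1 :> {poly R}.
    by rewrite -!polyC_exp -polyCD -polyC1; congr _%:P; rewrite -v1 /dot; ring.
  move=> e; rewrite polyCD !polyCM.
  transitivity (- (((xcoord v)%:P ^+ 2 + (ycoord v)%:P ^+ 2) * 'X -
    ((xcoord v)%:P ^+ 2 * b%:P + (ycoord v)%:P ^+ 2 * a%:P))); first by ring.
  by rewrite e mul1r.
by rewrite size_polyN size_XsubC.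
Qed.

Lemma size_lax_V P v : (size (lax_V P v) <= 2)%N.
Proof.
apply: size_add_bound; rewrite -polyCM mul_polyC;
  by apply: leq_trans (size_scale_leq _ _) _; rewrite size_CsubX.
Qed.

Lemma size_lax_W P : (size (lax_W P) <= 3)%N.
Proof.
have h c d : (size ((c : R)%:P ^+ 2 * (d%:P - 'X))%R <= 3)%N.
  rewrite -polyC_exp mul_polyC.
  by apply: leq_trans (size_scale_leq _ _) _; rewrite size_CsubX.
apply: size_add_bound; last by rewrite size_polyN.
apply: size_add_bound; last by rewrite size_polyN.
by apply: leq_trans (size_polyMleq _ _) _; rewrite !size_CsubX.
Qed.

(** Tangency makes (r, s) a nonzero kernel vector of the Gram matrix of (P : 1) and (v : 0) for the
    form of C_beta. Its determinant thus vanishes, which expresses (x q - y p)^2 through beta. Since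
    V^2 + U W = (a - X)(b - X)(U - (x q - y p)^2) and |v| = 1, the last factor is beta - X. *)
Lemma lax_disc beta P v : a - beta != 0 -> b - beta != 0 -> dot v v = 1 ->
  tangent_line a b beta P v ->
  lax_V P v ^+ 2 + lax_U v * lax_W P = cayley_cubic a b beta.
Proof.
move=> A0 B0 v1 [r [s [rs []]]]; set x := xcoord P; set y := ycoord P.
rewrite /polar_form /=.
have xT : xcoord (r *: P + s *: v) = r * x + s * xcoord v by rewrite /xcoord !mxE.
have yT : ycoord (r *: P + s *: v) = r * y + s * ycoord v by rewrite /ycoord !mxE.
rewrite xT yT -/x -/y; move: v1; rewrite /dot.
set p := xcoord v; set q := ycoord v => v1 _ e1 e2.
have k : (x * q - y * p) ^+ 2 = p ^+ 2 * (b - beta) + q ^+ 2 * (a - beta).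
  pose g11 := x * x / (a - beta) + y * y / (b - beta) - 1.
  pose g12 := x * p / (a - beta) + y * q / (b - beta).
  pose g22 := p * p / (a - beta) + q * q / (b - beta).
  have l1 : r * g11 + s * g12 = 0 by rewrite -e1 /g11 /g12; ring.
  have l2 : r * g12 + s * g22 = 0 by rewrite -e2 /g12 /g22; ring.
  have gr : r * (g11 * g22 - g12 ^+ 2) = 0.
    by transitivity (g22 * (r * g11 + s * g12) - g12 * (r * g12 + s * g22));
      [ring|rewrite l1 l2; ring].
  have gs : s * (g11 * g22 - g12 ^+ 2) = 0.
    by transitivity (g11 * (r * g12 + s * g22) - g12 * (r * g11 + s * g12));
      [ring|rewrite l1 l2; ring].
  have g : g11 * g22 - g12 ^+ 2 = 0.
    have [r0|r0] := eqVneq r 0; last by apply: (mulfI r0); rewrite mulr0.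
    have [s0|s0] := eqVneq s 0; last by apply: (mulfI s0); rewrite mulr0.
    by move: rs; rewrite r0 s0 eqxx.
  have e : (a - beta) * (b - beta) * (g11 * g22 - g12 ^+ 2) =
    (x * q - y * p) ^+ 2 - (p ^+ 2 * (b - beta) + q ^+ 2 * (a - beta)).
    by rewrite /g11 /g12 /g22; field; rewrite A0 B0.
  by move: e; rewrite g mulr0 => /esym/eqP; rewrite subr_eq0 => /eqP.
have kP : (x%:P * q%:P - y%:P * p%:P) ^+ 2 =
    p%:P ^+ 2 * (b%:P - beta%:P) + q%:P ^+ 2 * (a%:P - beta%:P).
  transitivity (((x * q - y * p) ^+ 2)%:P : {poly R}).
    by rewrite polyC_exp polyCB !polyCM.
  by rewrite k polyCD !(polyCM, polyCB); ring.
have vP : p%:P ^+ 2 + q%:P ^+ 2 = 1 :> {poly R}.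
  by rewrite -!polyC_exp -polyCD -polyC1; congr _%:P; rewrite -v1; ring.
rewrite /lax_V /lax_U /lax_W /cayley_cubic -/x -/y -/p -/q.
transitivity ((a%:P - 'X) * (b%:P - 'X) *
  (p%:P ^+ 2 * (b%:P - 'X) + q%:P ^+ 2 * (a%:P - 'X)
   - (x%:P * q%:P - y%:P * p%:P) ^+ 2)); first by ring.
rewrite kP; congr (_ * _).
transitivity ((p%:P ^+ 2 + q%:P ^+ 2) * (beta%:P - 'X)); first by ring.
by rewrite vP mul1r.
Qed.

Lemma lax_W0 P : a != 0 -> b != 0 -> confocal a b 0 P -> (lax_W P).[0] = 0.
Proof.
move=> a0 b0; rewrite /confocal /= !subr0 => e.
transitivity (a * b * (1 - (xcoord P ^+ 2 / a + ycoord P ^+ 2 / b))).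
  by rewrite !hornerE; field; rewrite a0 b0.
by rewrite e subrr mulr0.
Qed.

Lemma lax_eigen_a P v :
  (lax_V P v).[a] * xcoord P + (lax_W P).[a] * xcoord v = 0 /\
  (lax_U v).[a] * xcoord P = (lax_V P v).[a] * xcoord v.
Proof. by rewrite !hornerE subrr; split; ring. Qed.

Lemma lax_eigen_b P v :
  (lax_V P v).[b] * ycoord P + (lax_W P).[b] * ycoord v = 0 /\
  (lax_U v).[b] * ycoord P = (lax_V P v).[b] * ycoord v.
Proof. by rewrite !hornerE subrr; split; ring. Qed.

(** P' and v' are taken after the flip, and mu is the coefficient of the normal N in the reflection;
    the last equation is mu |N|^2 = 2 v.N. *)
Definition step_relation (t mu : R) P v P' v' :=
  [/\ t != 0, xcoord P' = xcoord P + t * xcoord v,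
      ycoord P' = - (ycoord P + t * ycoord v),
      a * xcoord v' = a * xcoord v - mu * xcoord P' &
      b * ycoord v' = - (b * ycoord v + mu * ycoord P')] /\
  mu * ((xcoord P' / a) ^+ 2 + (ycoord P' / b) ^+ 2) =
    2 * (xcoord v * (xcoord P' / a) - ycoord v * (ycoord P' / b)).

(** The sign of V(0) records that v points inwards at P; it later selects the branch of the square
    root of f. *)
Lemma magic_stepP P v P' v' : 0 < a -> 0 < b ->
  confocal a b 0 P -> magic_step a b P v P' v' ->
  (exists t mu, step_relation t mu P v P' v') /\ (lax_V P v).[0] < 0.
Proof.
move=> a0 b0 cP [t [t0 cA inside eP' ev']]; set A := P + t *: v in cA eP' ev'.
have an0 : a != 0 by rewrite gt_eqF.
have bn0 : b != 0 by rewrite gt_eqF.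
have xA s : xcoord (P + s *: v) = xcoord P + s * xcoord v by rewrite /xcoord !mxE.
have yA s : ycoord (P + s *: v) = ycoord P + s * ycoord v by rewrite /ycoord !mxE.
have xv2 (c d : R) : xcoord (vec2 c d) = c by rewrite /xcoord mxE.
have yv2 (c d : R) : ycoord (vec2 c d) = d by rewrite /ycoord mxE.
have xP' : xcoord P' = xcoord A by rewrite eP' xv2.
have yP' : ycoord P' = - ycoord A by rewrite eP' yv2.
pose N := ellipse_normal a b A.
have xN : xcoord N = xcoord A / a by rewrite xv2.
have yN : ycoord N = ycoord A / b by rewrite yv2.
have NN : dot N N != 0.
  apply/eqP; rewrite /dot -!expr2 => /eqP.
  rewrite paddr_eq0 ?sqr_ge0// !sqrf_eq0 xN yN.
  rewrite !mulf_eq0 !invr_eq0 (negbTE an0) (negbTE bn0) !orbF => /andP[/eqP x0 /eqP y0].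
  move: cA; rewrite /confocal /= x0 y0 expr0n /= !mul0r addr0 => /eqP.
  by rewrite eq_sym oner_eq0.
pose mu := 2 * dot v N / dot N N.
have xR (z w : 'rV[R]_2) : xcoord (z - mu *: w) = xcoord z - mu * xcoord w.
  by rewrite /xcoord !mxE.
have yR (z w : 'rV[R]_2) : ycoord (z - mu *: w) = ycoord z - mu * ycoord w.
  by rewrite /ycoord !mxE.
have xv' : xcoord v' = xcoord v - mu * (xcoord A / a).
  by rewrite ev' xv2 /reflect_at -/N -/mu xR xN.
have yv' : ycoord v' = - (ycoord v - mu * (ycoord A / b)).
  by rewrite ev' yv2 /reflect_at -/N -/mu yR yN.
split.
  exists t, mu; split; first split.
  + by rewrite gt_eqF.
  + by rewrite xP' xA.
  + by rewrite yP' yA.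
  + by rewrite xv' xP'; field.
  + by rewrite yv' yP'; field.
  rewrite xP' yP' mulNr sqrrN -xN -yN.
  have -> : xcoord N ^+ 2 + ycoord N ^+ 2 = dot N N by rewrite /dot -!expr2.
  by rewrite /mu divfK// /dot; ring.
have := inside (t / 2); rewrite !xA !yA.
have t2 : 0 < t / 2 by lra.
have t3 : t / 2 < t by lra.
rewrite t2 t3 => /(_ isT).
move: cA cP; rewrite /confocal /= !subr0 !xA !yA => cA cP h.
(* the quadratic [q(P + sv) - 1] vanishes at 0 and t and is negative at t/2 *)
pose g12 := xcoord P * xcoord v / a + ycoord P * ycoord v / b.
pose g22 := xcoord v ^+ 2 / a + ycoord v ^+ 2 / b.
have -> : (lax_V P v).[0] = a * b * g12.
  by rewrite !hornerE /g12; field; rewrite an0 bn0.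
rewrite pmulr_rlt0 ?mulr_gt0//.
have qE s : (xcoord P + s * xcoord v) ^+ 2 / a + (ycoord P + s * ycoord v) ^+ 2 / b
    = 1 + 2 * s * g12 + s ^+ 2 * g22.
  transitivity (xcoord P ^+ 2 / a + ycoord P ^+ 2 / b + 2 * s * g12 + s ^+ 2 * g22).
    by rewrite /g12 /g22; field; rewrite an0 bn0.
  by rewrite cP.
move: cA h; rewrite !qE => cA h.
have e : 2 * g12 + t * g22 = 0.
  by apply: (mulfI (lt0r_neq0 t0)); rewrite mulr0; lra.
have tg : t * g22 = - 2 * g12 by lra.
have : t * g12 + t / 4 * (t * g22) < 0 by lra.
rewrite tg => h2; have : t * g12 < 0 by lra.
by rewrite pmulr_rlt0.
Qed.

Section Step.
Variables (t mu : R) (P v P' v' : 'rV[R]_2).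
Hypotheses (a0 : 0 < a) (b0 : 0 < b) (cP' : confocal a b 0 P').
Hypothesis rel : step_relation t mu P v P' v'.

(** U, V and W are unchanged when the ordinates of P and v both change sign, so the flip is
    invisible here. *)
Lemma lax_W_step :
  lax_W P' = lax_W P - t%:P *+ 2 * lax_V P v - (t ^+ 2)%:P * lax_U v.
Proof.
case: rel => [[_ xP' yP' _ _] _]; rewrite /lax_W /lax_V /lax_U xP' yP'.
by rewrite polyC_exp polyCN !polyCD !polyCM; ring.
Qed.

(* Divisions are removed by writing x' = a n1 and y' = - b n2, where (n1, n2) is
   the normal at the point of impact, before the flip. *)
Lemma lax_V_step :
  'X * lax_V P' v' = 'X * (lax_V P v + t%:P * lax_U v) + mu%:P * lax_W P'.
Proof.
have an0 : a != 0 by rewrite gt_eqF.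
have bn0 : b != 0 by rewrite gt_eqF.
case: rel => [[_ xP' yP' xv' yv'] _].
have [n1 ex] : exists n1, xcoord P' = a * n1.
  by exists (xcoord P' / a); rewrite mulrC divfK.
have [n2 ey] : exists n2, ycoord P' = - (b * n2).
  by exists (- (ycoord P' / b)); rewrite mulrN opprK mulrC divfK.
have n12 : a%:P * n1%:P ^+ 2 + b%:P * n2%:P ^+ 2 = 1 :> {poly R}.
  rewrite -!polyC_exp -!polyCM -polyCD -polyC1; congr _%:P.
  by move: cP'; rewrite /confocal /= !subr0 ex ey => <-; field; rewrite an0 bn0.
have {}xv' : xcoord v' = xcoord v - mu * n1.
  by apply: (mulfI an0); rewrite xv' ex; ring.
have {}yv' : ycoord v' = - (ycoord v - mu * n2).
  by apply: (mulfI bn0); rewrite yv' ey; ring.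
have eP : (xcoord P)%:P = a%:P * n1%:P - t%:P * (xcoord v)%:P :> {poly R}.
  by rewrite -!polyCM -polyCB -ex xP'; congr _%:P; ring.
have eQ : (ycoord P)%:P = b%:P * n2%:P - t%:P * (ycoord v)%:P :> {poly R}.
  by rewrite -!polyCM -polyCB -[b * n2]opprK -ey yP'; congr _%:P; ring.
rewrite /lax_W /lax_V /lax_U eP eQ ex ey xv' yv' !(polyCN, polyCB, polyCM).
rewrite -[X in _ + mu%:P * (X - _ - _)]mulr1 -n12; ring.
Qed.

Lemma lax_U_step :
  'X * lax_U v' = 'X * lax_U v - mu%:P * (lax_V P v + t%:P * lax_U v + lax_V P' v').
Proof.
have an0 : a != 0 by rewrite gt_eqF.
have bn0 : b != 0 by rewrite gt_eqF.
case: rel => [[_ xP' yP' xv' yv'] emu].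
have [n1 ex] : exists n1, xcoord P' = a * n1.
  by exists (xcoord P' / a); rewrite mulrC divfK.
have [n2 ey] : exists n2, ycoord P' = - (b * n2).
  by exists (- (ycoord P' / b)); rewrite mulrN opprK mulrC divfK.
have n12 : n1%:P * (2 * (xcoord v)%:P - mu%:P * n1%:P) +
    n2%:P * (2 * (ycoord v)%:P - mu%:P * n2%:P) = 0 :> {poly R}.
  rewrite -polyC_natr -!polyCM -!polyCB -!polyCM -polyCD -polyC0; congr _%:P.
  move: emu; rewrite ex ey.
  rewrite (_ : a * n1 / a = n1); last by field.
  rewrite (_ : - (b * n2) / b = - n2); last by field.
  by move=> e; lra.
have {}xv' : xcoord v' = xcoord v - mu * n1.
  by apply: (mulfI an0); rewrite xv' ex; ring.
have {}yv' : ycoord v' = - (ycoord v - mu * n2).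
  by apply: (mulfI bn0); rewrite yv' ey; ring.
have eP : (xcoord P)%:P = a%:P * n1%:P - t%:P * (xcoord v)%:P :> {poly R}.
  by rewrite -!polyCM -polyCB -ex xP'; congr _%:P; ring.
have eQ : (ycoord P)%:P = b%:P * n2%:P - t%:P * (ycoord v)%:P :> {poly R}.
  by rewrite -!polyCM -polyCB -[b * n2]opprK -ey yP'; congr _%:P; ring.
rewrite /lax_V /lax_U eP eQ ex ey xv' yv' !(polyCN, polyCB, polyCM).
apply/eqP; rewrite -subr_eq0; apply/eqP.
(* The two sides differ by a multiple of 2 v.N - mu |N|^2, which is 0. *)
transitivity (mu%:P * (a%:P - 'X) * (b%:P - 'X) *
 (n1%:P * (2 * (xcoord v)%:P - mu%:P * n1%:P) +
    n2%:P * (2 * (ycoord v)%:P - mu%:P * n2%:P))); first by ring.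
by rewrite n12 mulr0.
Qed.

End Step.
End LaxPolynomials.

(** * Cayley's conditions for periodicity *)

Lemma dvd_CsubX {F : fieldType} (c : F) (p : {poly F}) :
  (c%:P - 'X %| p) = (p.[c] == 0).
Proof. by rewrite -opprB dvdpNl dvdp_XsubCl rootE. Qed.

Lemma coprime_CsubX {F : fieldType} (c d : F) :
  c != d -> coprimep (c%:P - 'X) (d%:P - 'X).
Proof.
move=> cd; rewrite -(opprB _ c%:P) -(opprB _ d%:P).
rewrite -(scaleN1r ('X - c%:P)) coprimepZl ?oppr_eq0 ?oner_eq0//.
rewrite -(scaleN1r ('X - d%:P)) coprimepZr ?oppr_eq0 ?oner_eq0//.
by rewrite coprimep_XsubC rootE !hornerE subr_eq0 eq_sym.
Qed.

(** Over the fraction field the traceless part of T is proportional to L. The factor is a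
    polynomial: U is linear and V, W do not both vanish at its root, so U divides the lower-left
    entry of T. *)
Lemma commute_lax {R : realFieldType} (U V W : {poly R}) (T : 'M[{poly R}]_2) :
  size U = 2 -> (forall u, U.[u] = 0 -> V.[u] = 0 -> W.[u] != 0) ->
  T *m lax U V W = lax U V W *m T ->
  exists B : {poly R}, T = (2^-1 *: (T 0 0 + T 1 1))%:M + B *: lax U V W.
Proof.
move=> sU nd; rewrite (mx2_eta T) !mx2E; move: (T 0 0) (T 0 1) (T 1 0) (T 1 1).
move=> p q r s; rewrite !mul_mx2 => /mx2_inj[e1 e2 e3 _].
have U0 : U != 0 by rewrite -size_poly_eq0 sU.
have [u ru] := poly2_root sU.
have Uu : U.[u] = 0 by apply/eqP; rewrite -rootE.
have qU : q * U = W * r.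
  apply/eqP; rewrite -subr_eq0; apply/eqP.
  transitivity (- (p * - V + q * - U - (- V * p + - W * r))); first by ring.
  by rewrite e1 subrr oppr0.
have psU : (p - s) * U = 2 * V * r.
  apply/eqP; rewrite -subr_eq0; apply/eqP.
  transitivity (r * - V + s * - U - (- U * p + V * r)) => [|]; first by ring.
  by rewrite e3 subrr.
have ru0 : r.[u] = 0.
  have [Vu|Vu] := eqVneq V.[u] 0.
    apply: (mulfI (nd u Uu Vu)); rewrite mulr0.
    by have := congr1 (horner^~ u) qU; rewrite /= !hornerM Uu mulr0 => <-.
  apply: (mulfI Vu); rewrite mulr0; apply: (mulfI (_ : 2 != 0 :> R)).
    by rewrite pnatr_eq0.
  have := congr1 (horner^~ u) psU; rewrite /= !hornerM Uu !mulr0 -mulrA.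
  by rewrite -polyC_natr hornerC => <-.
have Ur : U %| r.
  have XU : 'X - u%:P %= U by rewrite -dvdp_size_eqp ?dvdp_XsubCl// sU size_XsubC.
  by rewrite -(eqp_dvdl _ XU) dvdp_XsubCl rootE ru0.
have /dvdpP[B0 er] := Ur; exists (- B0).
have eq : q = W * B0 by apply: (mulIf U0); rewrite qU er; ring.
have eps : p - s = 2 * V * B0 by apply: (mulIf U0); rewrite psU er; ring.
have half (x : {poly R}) : 2^-1 *: (x *+ 2) = x.
  by rewrite -(scaler_nat 2 x) scalerA mulVf ?scale1r// pnatr_eq0.
rewrite scalar_mx2 scale_mx2 add_mx2; congr mx2.
- rewrite -[LHS]half (_ : p *+ 2 = (p + s) + (p - s)); last by ring.
  rewrite eps (_ : 2 * V * B0 = (V * B0) *+ 2); last by ring.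
  by rewrite scalerDr half; ring.
- by rewrite eq; ring.
- by rewrite er; ring.
- rewrite -[LHS]half (_ : s *+ 2 = (p + s) - (p - s)); last by ring.
  rewrite eps (_ : 2 * V * B0 = (V * B0) *+ 2); last by ring.
  by rewrite scalerBr half; ring.
Qed.

Lemma nondegenerate_caustic_neq {R : realType} (a b beta : R) : 0 < b -> b < a ->
  nondegenerate_caustic a b beta -> [/\ 0 < beta, a != beta & b != beta].
Proof.
move=> b0 ba [/andP[beta0 h]|/andP[h h']]; split=> //.
- by rewrite gt_eqF// (lt_trans h).
- by rewrite gt_eqF.
- exact: lt_trans h.
- by rewrite gt_eqF.
- by rewrite lt_eqF.
Qed.

(** * From Pell's equation to the determinants *)

Section Forward.
Context {R : realType}.
Variables (a b beta : R) (n : nat) (A B : {poly R}).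
Hypotheses (b_gt0 : 0 < b) (ba : b < a) (nd : nondegenerate_caustic a b beta).
Hypotheses (n_gt0 : (0 < n)%N)
  (pell : A ^+ 2 - cayley_cubic a b beta * B ^+ 2 = 'X^(2 * n))
  (A0 : A.[0] != 0) (sA : (size (A - 'X^n)%R <= n)%N)
  (Aa : A.[a] = a ^+ n) (Ab : A.[b] = (- b) ^+ n).

Let a_gt0 : 0 < a. Proof. exact: lt_trans ba. Qed.

Let beta_gt0 : 0 < beta.
Proof. by have [] := nondegenerate_caustic_neq b_gt0 ba nd. Qed.

Let ab : a != b. Proof. by rewrite gt_eqF. Qed.
Let abeta : a != beta.
Proof. by have [] := nondegenerate_caustic_neq b_gt0 ba nd. Qed.
Let bbeta : b != beta.
Proof. by have [] := nondegenerate_caustic_neq b_gt0 ba nd. Qed.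

Let sAp : size (A + 'X^n) = n.+1 /\ lead_coef (A + 'X^n) = 2.
Proof.
have -> : A + 'X^n = 2 *: 'X^n + (A - 'X^n).
  by rewrite -mul_polyC polyC_natr; ring.
have s2 : size (2 *: 'X^n : {poly R}) = n.+1.
  by rewrite size_scale ?pnatr_eq0// size_polyXn.
by rewrite size_polyDl ?lead_coefDl ?s2// lead_coefZ lead_coefXn mulr1.
Qed.

(** A + X^n = c2 f2 P^2 has degree n, so n and the degree of f2 have the same parity. This decides
    which factor contains beta - X. *)
Let parity (f1 f2 : {poly R}) : cayley_cubic a b beta = f1 * f2 ->
  f1 != 0 -> f2 != 0 -> f1 %| A - 'X^n -> f2 %| A + 'X^n ->
  odd n = ~~ odd (size f2).
Proof.
move=> ef f10 f20 d1 d2; have pell' := pell; rewrite ef in pell'.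
have [c1 [c2 [Q [P [c10 c20 _ eP]]]]] := pell_factor n_gt0 pell' A0 f10 f20 d1 d2.
have P0 : P != 0.
  apply/eqP => P0; have [] := sAp; rewrite eP P0 expr0n mulr0 scaler0.
  by rewrite size_poly0.
have [s _] := sAp; move: s; rewrite eP size_scale// expr2 !size_mul ?mulf_neq0//.
have := size_poly_gt0 P; rewrite P0; have := size_poly_gt0 f2; rewrite f20.
move: (size P) (size f2); clear => i j j0 i0 e.
have -> : n = (j + (i.-1).*2)%N.-1 by move: e i0 j0; clear; lia.
by case: j j0 {e} => // j _; rewrite addSn /= oddD odd_double addbF negbK.
Qed.

Let beta_root : (beta%:P - 'X %| A - 'X^n) || (beta%:P - 'X %| A + 'X^n).
Proof.
rewrite !dvd_CsubX -mulf_eq0 -hornerM.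
have -> : (A - 'X^n) * (A + 'X^n) = cayley_cubic a b beta * B ^+ 2.
  by transitivity (A ^+ 2 - 'X^(2 * n)); [rewrite mulnC exprM; ring|rewrite -pell; ring].
by rewrite hornerM [X in X * _]hornerM hornerD hornerN hornerX hornerC subrr mulr0 mul0r.
Qed.

Let Cn0 (c : R) : c%:P - 'X != 0 :> {poly R}.
Proof. by rewrite -size_poly_eq0 size_CsubX. Qed.

(** The values at a and b put a - X and b - X into A - X^n, and parity puts beta - X there too: f1 =
    f and f2 = 1. *)
Lemma forward_even : ~~ odd n -> \det (hankel (taylor_B a b beta) 3 (n %/ 2 - 1)) = 0.
Proof.
move=> ne.
have da : a%:P - 'X %| A - 'X^n by rewrite dvd_CsubX hornerD hornerN hornerXn Aa subrr.
have db : b%:P - 'X %| A - 'X^n.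
  rewrite dvd_CsubX hornerD hornerN hornerXn Ab exprNn -signr_odd (negbTE ne).
  by rewrite mul1r subrr.
have dab : (a%:P - 'X) * (b%:P - 'X) %| A - 'X^n.
  by rewrite Gauss_dvdp ?da// coprime_CsubX.
have dbeta : beta%:P - 'X %| A - 'X^n.
  have /orP[//|d] := beta_root.
  have := parity erefl (mulf_neq0 (Cn0 a) (Cn0 b)) (Cn0 beta) dab d.
  by rewrite size_CsubX (negbTE ne).
have df : cayley_cubic a b beta %| A - 'X^n.
  by rewrite /cayley_cubic Gauss_dvdp ?dab// coprimepMl !coprime_CsubX.
have en : n = (2 * (n %/ 2 - 1) + 3 - 1)%N.
  rewrite divn2; have := odd_double_half n; rewrite (negbTE ne); move: n_gt0 (n./2).
  by clear; lia.
apply/(hankel_det_eq0 (p := taylor_B_poly a b beta (2 * n))) => //.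
  move=> k kn; rewrite coef_poly ifT//; move: kn n_gt0 en; clear; lia.
apply: (@cayley_of_pell _ n _ 3 0 (cayley_cubic a b beta) 1
  (taylor_B_poly a b beta (2 * n)) _ n_gt0 en _ _ _ _ _ _ _ A B) => //.
- rewrite /cayley_cubic !size_mul ?mulf_neq0// !size_CsubX//.
- by rewrite size_poly1.
- by rewrite /cayley_cubic !hornerE !mulr_gt0 ?subr0.
- by rewrite !hornerE.
- by rewrite mulr1; exact: taylor_B_sqr.
- by rewrite mul1r subrr dvdp0.
- by rewrite mulr1.
- exact: dvd1p.
Qed.

(** Now A(b) = -b^n puts b - X into A + X^n; with beta - X there as well, f2 would have even degree,
    against [parity]. *)
Let odd_facts : odd n ->
  (a%:P - 'X) * (beta%:P - 'X) %| A - 'X^n /\ b%:P - 'X %| A + 'X^n.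
Proof.
move=> no.
have da : a%:P - 'X %| A - 'X^n by rewrite dvd_CsubX hornerD hornerN hornerXn Aa subrr.
have db : b%:P - 'X %| A + 'X^n.
  by rewrite dvd_CsubX hornerD hornerXn Ab exprNn -signr_odd no mulN1r addNr.
split=> //; rewrite Gauss_dvdp ?coprime_CsubX// da /=.
have /orP[//|d] := beta_root.
have dbb : (b%:P - 'X) * (beta%:P - 'X) %| A + 'X^n.
  by rewrite Gauss_dvdp ?db// coprime_CsubX.
have ef : cayley_cubic a b beta = (a%:P - 'X) * ((b%:P - 'X) * (beta%:P - 'X)).
  by rewrite mulrA.
have := parity ef (Cn0 a) (mulf_neq0 (Cn0 b) (Cn0 beta)) da dbb.
by rewrite size_mul// !size_CsubX no.
Qed.

Let ef_odd : cayley_cubic a b beta = (a%:P - 'X) * (beta%:P - 'X) * (b%:P - 'X).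
Proof. by rewrite mulrAC. Qed.

(** Signs are compared: the leading coefficient gives c2 < 0, the value at 0 then gives A(0) < 0 and
    c1 < 0, and A(b) - b^n = -2 b^n forces beta > b. *)
Lemma forward_hyperbola : odd n -> confocal_is_hyperbola a b beta.
Proof.
move=> no; have [d1 d2] := odd_facts no.
have pell' := pell; rewrite ef_odd in pell'.
have [c1 [c2 [Q [P [c10 c20 eQ eP]]]]] :=
  pell_factor n_gt0 pell' A0 (mulf_neq0 (Cn0 a) (Cn0 beta)) (Cn0 b) d1 d2.
have c2_lt0 : c2 < 0.
  have [_] := sAp; rewrite eP lead_coefZ lead_coefM lead_coef_exp.
  rewrite -(opprB 'X) lead_coefN lead_coefXsubC => e.
  rewrite ltNge; apply/negP => c2_ge0.
  have := sqr_ge0 (lead_coef P) => l0.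
  have := mulr_ge0 c2_ge0 l0.
  by rewrite -oppr_le0 -mulrN -mulN1r e lern0.
have X0 : 0 ^+ n = 0 :> R by rewrite expr0n eqn0Ngt n_gt0.
have eQ0 : A.[0] = c1 * (a * beta * Q.[0] ^+ 2).
  by have := congr1 (horner^~ 0) eQ; rewrite /= !hornerE X0 !subr0.
have eP0 : A.[0] = c2 * (b * P.[0] ^+ 2).
  by have := congr1 (horner^~ 0) eP; rewrite /= !hornerE X0 addr0 subr0.
have A0_lt0 : A.[0] < 0.
  rewrite lt_neqAle A0 /= eP0 nmulr_rle0//.
  by rewrite mulr_ge0 ?sqr_ge0// ltW.
have c1_lt0 : c1 < 0.
  rewrite ltNge; apply/negP => c1_ge0; move: A0_lt0; rewrite eQ0 ltNge => /negP; apply.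
  apply: mulr_ge0 => //; apply: mulr_ge0; last exact: sqr_ge0.
  by apply: mulr_ge0; exact: ltW.
have eb : - 2 * b ^+ n = c1 * ((a - b) * (beta - b) * Q.[b] ^+ 2).
  have := congr1 (horner^~ b) eQ; rewrite /= !hornerE Ab exprNn -signr_odd no.
  by move=> <-; ring.
have pos : 0 < (a - b) * (beta - b) * Q.[b] ^+ 2.
  rewrite -(nmulr_rlt0 _ c1_lt0) -eb mulNr oppr_lt0 mulr_gt0 ?exprn_gt0//.
have bb : b < beta.
  rewrite ltNge; apply/negP => hb; move: pos; rewrite ltNge => /negP; apply.
  rewrite -mulrA pmulr_rle0 ?subr_gt0//; apply: mulr_le0_ge0; last exact: sqr_ge0.
  by rewrite subr_le0.
by case: nd => // /andP[_ /(lt_trans bb)]; rewrite ltxx.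
Qed.

Lemma forward_odd : odd n -> \det (hankel (taylor_C a b beta) 2 ((n - 1) %/ 2)) = 0.
Proof.
move=> no; have [d1 d2] := odd_facts no.
have en : n = (2 * ((n - 1) %/ 2) + 2 - 1)%N.
  have := odd_double_half n; rewrite no; move: (n./2) => k; clear; lia.
apply/(hankel_det_eq0 (p := taylor_C_poly a b beta (2 * n))) => //.
  move=> k kn; rewrite coef_poly ifT//; move: kn n_gt0 en; clear; lia.
apply: (@cayley_of_pell _ n _ 2 1 ((a%:P - 'X) * (beta%:P - 'X)) (b%:P - 'X)
  (taylor_B_poly a b beta (2 * n)) _ n_gt0 en _ _ _ _ _ _ _ A B) => //.
- by rewrite size_mul// !size_CsubX.
- by rewrite size_CsubX.
- by rewrite !hornerE !mulr_gt0 ?subr0.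
- by rewrite !hornerE subr0.
- by rewrite -ef_odd; exact: taylor_B_sqr.
- exact: taylor_C_mul.
- by rewrite -ef_odd.
Qed.

End Forward.

Lemma vec2P {R : realType} (u w : 'rV[R]_2) :
  xcoord u = xcoord w -> ycoord u = ycoord w -> u = w.
Proof.
move=> ex ey; apply/rowP => i.
by case: i => [[|[|//]] ?]; [move: ex|move: ey]; rewrite /xcoord /ycoord;
  congr (_ = _); congr (_ _ _); apply: val_inj.
Qed.

(* (z, u) spans the kernel of L at c, where the commutant of L therefore acts
   through its scalar part. *)
Lemma lax_kernel_scalar {R : fieldType} (A B U V W : {poly R}) (c z u : R) :
  V.[c] * z + W.[c] * u = 0 -> U.[c] * z = V.[c] * u ->
  let M := A%:M + B *: lax U V W in
  (M 0 0).[c] * z + (M 0 1).[c] * u = A.[c] * z /\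
  (M 1 0).[c] * z + (M 1 1).[c] * u = A.[c] * u.
Proof.
move=> k1 k2 M; rewrite /M scalar_mx2 /lax scale_mx2 add_mx2 !mx2E !hornerE; split.
- transitivity (A.[c] * z - B.[c] * (V.[c] * z + W.[c] * u)); first by ring.
  by rewrite k1; ring.
- transitivity (A.[c] * u - B.[c] * (U.[c] * z - V.[c] * u)); first by ring.
  by rewrite k2; ring.
Qed.

(** * Lax matrices along a trajectory *)

Section Trajectory.
Context {R : realType}.
Variables (a b beta : R) (P v : nat -> 'rV[R]_2) (n : nat) (t mu : nat -> R).
Hypotheses (b_gt0 : 0 < b) (ba : b < a) (nd : nondegenerate_caustic a b beta).
Hypotheses (n_gt0 : (0 < n)%N) (caustic : has_caustic a b beta P v).
Hypotheses (onE : forall k, confocal a b 0 (P k)) (unit_v : forall k, dot (v k) (v k) = 1).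
Hypothesis rel : forall k, step_relation a b (t k) (mu k) (P k) (v k) (P k.+1) (v k.+1).
Hypothesis V_lt0 : forall k, (lax_V a b (P k) (v k)).[0] < 0.

Let a_gt0 : 0 < a. Proof. exact: lt_trans ba. Qed.
Let beta_gt0 : 0 < beta.
Proof. by have [] := nondegenerate_caustic_neq b_gt0 ba nd. Qed.
Let ab : a != b. Proof. by rewrite gt_eqF. Qed.
Let abeta : a != beta.
Proof. by have [] := nondegenerate_caustic_neq b_gt0 ba nd. Qed.
Let bbeta : b != beta.
Proof. by have [] := nondegenerate_caustic_neq b_gt0 ba nd. Qed.

Let U k := lax_U a b (v k).
Let V k := lax_V a b (P k) (v k).
Let W k := lax_W a b (P k).
Let f := cayley_cubic a b beta.
Let w := taylor_B_poly a b beta (2 * n).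
Let L k := lax (U k) (V k) (W k).
Let T := monodromy t mu n.

Let fE x : f.[x] = (a - x) * (b - x) * (beta - x).
Proof. by rewrite /f /cayley_cubic !hornerE. Qed.

Let laxf k : V k ^+ 2 + U k * W k = f.
Proof.
by apply: lax_disc (unit_v k) (caustic k); rewrite subr_eq0.
Qed.

Let W_at0 k : (W k).[0] = 0.
Proof. by apply: lax_W0 (onE k); rewrite gt_eqF. Qed.

Let w_at0 : 0 < w.[0] /\ w.[0] ^+ 2 = a * b * beta.
Proof. by apply: taylor_B_poly0; rewrite // muln_gt0. Qed.

(** On the boundary W(0) = 0, so V(0)^2 = f(0); the inward direction fixes the sign. *)
Let V_at0 k : (V k).[0] = - w.[0].
Proof.
have [w0 w2] := w_at0.
have : (V k).[0] ^+ 2 == w.[0] ^+ 2.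
  have := congr1 (horner^~ 0) (laxf k).
  by rewrite /= hornerD horner_exp hornerM W_at0 mulr0 addr0 fE !subr0 w2 => ->.
rewrite eqf_sqr => /orP[/eqP e|/eqP//].
by have := V_lt0 k; rewrite -/(V k) e ltNge ltW.
Qed.

Let w_neq0 : w.[0] != 0. Proof. by case: w_at0 => /gt_eqF->. Qed.

Let t_neq0 k : t k != 0. Proof. by case: (rel k) => [[]]. Qed.

Let W_step k : W k.+1 = W k - (t k)%:P *+ 2 * V k - (t k ^+ 2)%:P * U k.
Proof. exact: lax_W_step (rel k). Qed.

Let V_step k : 'X * V k.+1 = 'X * (V k + (t k)%:P * U k) + (mu k)%:P * W k.+1.
Proof. exact: (lax_V_step a_gt0 b_gt0 (onE k.+1) (rel k)). Qed.

Let lax_step k : step_mx (t k) (mu k) *m L k = L k.+1 *m step_mx (t k) (mu k).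
Proof.
apply: step_lax; [exact: W_step|exact: V_step|].
exact: (lax_U_step a_gt0 b_gt0 (rel k)).
Qed.

Let tU k : t k * (U k).[0] = 2 * w.[0].
Proof.
have E (c : R) (p q r : {poly R}) : (p - c%:P *+ 2 * q - (c ^+ 2)%:P * r).[0] =
    p.[0] - 2 * c * q.[0] - c ^+ 2 * r.[0] by rewrite !hornerE; ring.
have := W_at0 k.+1; rewrite W_step E W_at0 V_at0 => e.
apply: (mulfI (t_neq0 k)); apply/eqP; rewrite -subr_eq0 -oppr_eq0.
by apply/eqP; rewrite -[RHS]e; ring.
Qed.

Let U_at0 k : (U k).[0] != 0.
Proof.
apply: contraNneq w_neq0 => U0; have := tU k.
by rewrite U0 mulr0 => /esym/eqP; rewrite mulf_eq0 pnatr_eq0.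
Qed.

(** Without a reflection V(0) would change sign during the flight, but it is the same at every
    start. *)
Let mu_neq0 k : mu k != 0.
Proof.
have E (c : R) (p q : {poly R}) : (p + c%:P * q).[0] = p.[0] + c * q.[0].
  by rewrite !hornerE.
apply: contraNneq w_neq0 => mu0; have := V_step k.
rewrite mu0 polyC0 mul0r addr0 => /(mulfI (negbT (polyX_eq0 R))).
move/(congr1 (horner^~ 0)); rewrite /= E !V_at0 tU => e.
have : 2 * w.[0] == 0 by rewrite -[X in X == _](addKr (- w.[0])) -e addNr.
by rewrite mulf_eq0 pnatr_eq0.
Qed.

Lemma monodromy_a :
  (T 0 0).[a] * xcoord (P 0) + (T 0 1).[a] * xcoord (v 0) = a ^+ n * xcoord (P n) /\
  (T 1 0).[a] * xcoord (P 0) + (T 1 1).[a] * xcoord (v 0) = a ^+ n * xcoord (v n).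
Proof.
apply: (monodromy_eval (z := xcoord \o P) (u := xcoord \o v)) => k /=;
  case: (rel k) => [[_ ex _ ev _] _]; first by rewrite ex.
by rewrite -ex ev.
Qed.

Lemma monodromy_b :
  (T 0 0).[b] * ycoord (P 0) + (T 0 1).[b] * ycoord (v 0) = (- b) ^+ n * ycoord (P n) /\
  (T 1 0).[b] * ycoord (P 0) + (T 1 1).[b] * ycoord (v 0) = (- b) ^+ n * ycoord (v n).
Proof.
apply: (monodromy_eval (z := ycoord \o P) (u := ycoord \o v)) => k /=;
  case: (rel k) => [[_ _ ey _ ev] _]; first by rewrite ey; ring.
by rewrite mulNr ev ey; ring.
Qed.

Lemma monodromy_scalar A B : T = A%:M + B *: L 0 ->
  [/\ A.[a] * xcoord (P 0) = a ^+ n * xcoord (P n),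
      A.[a] * xcoord (v 0) = a ^+ n * xcoord (v n),
      A.[b] * ycoord (P 0) = (- b) ^+ n * ycoord (P n) &
      A.[b] * ycoord (v 0) = (- b) ^+ n * ycoord (v n)].
Proof.
move=> eT; have [a1 a2] := monodromy_a; have [b1 b2] := monodromy_b.
have [ka1 ka2] := lax_eigen_a a b (P 0) (v 0).
have [kb1 kb2] := lax_eigen_b a b (P 0) (v 0).
have [sa1 sa2] := lax_kernel_scalar A B ka1 ka2.
have [sb1 sb2] := lax_kernel_scalar A B kb1 kb2.
by rewrite -a1 -a2 -b1 -b2 eT; split.
Qed.

(** Motion along the minor axis would give V(0)^2 = a^2 b, hence beta = a, a degenerate caustic. *)
Let x_nonzero : ~ (xcoord (P 0) = 0 /\ xcoord (v 0) = 0).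
Proof.
case=> x0 p0; have := congr1 (horner^~ 0) (laxf 0).
rewrite fE /= hornerD horner_exp hornerM W_at0 mulr0 addr0.
rewrite /V /lax_V x0 p0 !hornerE.
have := unit_v 0; rewrite /dot p0 mulr0 add0r.
have := onE 0; rewrite /confocal /= x0 expr0n mul0r add0r !subr0 => y2 q2 e.
have {}y2 : ycoord (P 0) ^+ 2 = b by rewrite -[RHS]mul1r -y2 divfK// gt_eqF.
move: e; rewrite -expr2 in q2; rewrite !exprMn y2 q2.
rewrite mulr1 expr2 => e.
have : a * b * (a - beta) = 0 by rewrite mulrBr -e; ring.
by move/eqP; rewrite !mulf_eq0 (gt_eqF a_gt0) (gt_eqF b_gt0) subr_eq0 (negbTE abeta).
Qed.

Let y_nonzero : ~ (ycoord (P 0) = 0 /\ ycoord (v 0) = 0).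
Proof.
case=> x0 p0; have := congr1 (horner^~ 0) (laxf 0).
rewrite fE /= hornerD horner_exp hornerM W_at0 mulr0 addr0.
rewrite /V /lax_V x0 p0 !hornerE.
have := unit_v 0; rewrite /dot p0 mulr0 addr0.
have := onE 0; rewrite /confocal /= x0 expr0n mul0r addr0 !subr0 => y2 q2 e.
have {}y2 : xcoord (P 0) ^+ 2 = a by rewrite -[RHS]mul1r -y2 divfK// gt_eqF.
move: e; rewrite -expr2 in q2; rewrite !exprMn y2 q2.
rewrite mulr1 expr2 => e.
have : a * b * (b - beta) = 0 by rewrite mulrBr -e; ring.
by move/eqP; rewrite !mulf_eq0 (gt_eqF a_gt0) (gt_eqF b_gt0) subr_eq0 (negbTE bbeta).
Qed.

(** A common zero of U, V and W would be a double root of f = V^2 + U W, whose roots a, b, beta are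
    distinct. *)
Let lax_nondegenerate u : (U 0).[u] = 0 -> (V 0).[u] = 0 -> (W 0).[u] != 0.
Proof.
move=> Uu Vu; apply/eqP => Wu.
have d1 : ('X - u%:P) %| U 0 by rewrite dvdp_XsubCl rootE Uu.
have d2 : ('X - u%:P) %| V 0 by rewrite dvdp_XsubCl rootE Vu.
have d3 : ('X - u%:P) %| W 0 by rewrite dvdp_XsubCl rootE Wu.
have d : ('X - u%:P) ^+ 2 %| f.
  by rewrite -(laxf 0); apply: dvdp_add; rewrite ?dvdp_exp2r// expr2; apply: dvdp_mul.
have fu : f.[u] = 0.
  apply/eqP; rewrite -rootE -dvdp_XsubCl; apply: dvdp_trans d.
  by rewrite expr2 dvdp_mulIl.
have f'u : f^`().[u] = 0.
  have lu : ('X - u%:P).[u] = 0 by rewrite hornerXsubC subrr.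
  move: ('X - u%:P) lu d => l lu /dvdpP[g ->].
  rewrite expr2 !derivM hornerD !hornerM hornerD !hornerM.
  by rewrite lu !(mul0r, mulr0, addr0).
move: fu f'u; rewrite fE /f /cayley_cubic !derivM !derivB !derivC derivX !hornerE.
move=> /eqP; rewrite !mulf_eq0 !subr_eq0 => /orP[/orP[]|] /eqP <- e.
- have : (b - a) * (beta - a) = 0 by rewrite -[RHS]oppr0 -e; ring.
  move/eqP; rewrite mulf_eq0 !subr_eq0 (eq_sym b a) (eq_sym beta a).
  by rewrite (negbTE ab) (negbTE abeta).
- have : (a - b) * (beta - b) = 0 by rewrite -[RHS]oppr0 -e; ring.
  by move/eqP; rewrite mulf_eq0 !subr_eq0 (eq_sym beta b) (negbTE ab) (negbTE bbeta).
- have : (a - beta) * (b - beta) = 0 by rewrite -[RHS]oppr0 -e; ring.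
  by move/eqP; rewrite mulf_eq0 !subr_eq0 (negbTE abeta) (negbTE bbeta).
Qed.

Lemma pell_of_periodic : n_periodic n P v -> exists A B : {poly R},
  [/\ A ^+ 2 - f * B ^+ 2 = 'X^(2 * n), A.[0] != 0, (size (A - 'X^n)%R <= n)%N,
      A.[a] = a ^+ n & A.[b] = (- b) ^+ n].
Proof.
move=> [eP ev]; have TL : T *m L 0 = L 0 *m T.
  by rewrite {1}/T (monodromy_lax lax_step) /U /V /W eP ev.
have [B eT] := commute_lax (size_lax_U a b (unit_v 0)) lax_nondegenerate TL.
set A := 2^-1 *: _ in eT; exists A, B.
have [T00 T11] := monodromy_at0 t_neq0 mu_neq0 n_gt0.
have [u00 _ _ u11] := unip_monodromy t mu n.
have [ea1 ea2 eb1 eb2] := monodromy_scalar eT; split.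
- rewrite -(det_monodromy t mu n) -/T eT scalar_mx2 /L /lax scale_mx2 add_mx2 det_mx2.
  by rewrite -(laxf 0) -/(U 0); ring.
- rewrite /A hornerZ hornerD T00 add0r mulf_neq0 ?invr_eq0 ?pnatr_eq0//.
- have -> : A - 'X^n = 2^-1 *: ((T 0 0 - 'X^n) + (T 1 1 - 'X^n)).
    rewrite /A -addrACA -opprD scalerBr; congr (_ - _).
    by rewrite -mulr2n -(scaler_nat 2 'X^n) scalerA mulVf ?scale1r// pnatr_eq0.
  by apply: leq_trans (size_scale_leq _ _) _; apply: size_add_bound.
(* At X = a the monodromy multiplies (x, v_x) both by A(a) and by a^n, and this pair is nonzero. *)
- move: ea1 ea2; rewrite eP ev => ea1 ea2.
  have [x0|x0] := eqVneq (xcoord (P 0)) 0; last exact: (mulIf x0).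
  have [p0|p0] := eqVneq (xcoord (v 0)) 0; last exact: (mulIf p0).
  by case: x_nonzero.
- move: eb1 eb2; rewrite eP ev => eb1 eb2.
  have [y0|y0] := eqVneq (ycoord (P 0)) 0; last exact: (mulIf y0).
  have [q0|q0] := eqVneq (ycoord (v 0)) 0; last exact: (mulIf q0).
  by case: y_nonzero.
Qed.

(** B has degree at most n - 2, so A + B L is unipotent at infinity although W is quadratic. It thus
    equals T, whose action at a and b gives the return. *)
Lemma periodic_of_pell A B :
  'X^(2 * n) %| A + B * w -> (size (A - 'X^n)%R <= n)%N -> (size B <= n.-1)%N ->
  A.[a] = a ^+ n -> A.[b] = (- b) ^+ n -> n_periodic n P v.
Proof.
move=> AB sA sB Aa Ab.
have fw : 'X^(2 * n) %| f - w ^+ 2 by exact: taylor_B_sqr.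
have BV : (size (B * V 0)%R <= n)%N.
  rewrite -(prednK n_gt0) -addn1; apply: size_mul_bound => //; exact: size_lax_V.
have BU : (size (B * U 0)%R <= n)%N.
  by rewrite -(prednK n_gt0) -addn1; apply: size_mul_bound => //;
    rewrite (size_lax_U a b (unit_v 0)).
have BW : (size (B * W 0)%R <= n.+1)%N.
  rewrite -(prednK n_gt0) -addn2; apply: size_mul_bound => //; exact: size_lax_W.
have uni : unip_at_infty n (A%:M + B *: L 0).
  rewrite scalar_mx2 /L /lax scale_mx2 add_mx2 /unip_at_infty !mx2E !add0r !mulrN.
  rewrite !size_polyN; split=> //; rewrite addrAC; apply: size_add_bound => //.
  by rewrite size_polyN.
have eT := monodromy_unique lax_step t_neq0 laxf W_at0 V_at0 w_neq0 W_step V_step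
  fw AB uni (U_at0 0).
have [ea1 ea2 eb1 eb2] := monodromy_scalar eT.
have an : a ^+ n != 0 by rewrite expf_neq0// gt_eqF.
have bn : (- b) ^+ n != 0 by rewrite expf_neq0// oppr_eq0 gt_eqF.
split; apply: vec2P.
- by apply: (mulfI an); rewrite -ea1 Aa.
- by apply: (mulfI bn); rewrite -eb1 Ab.
- by apply: (mulfI an); rewrite -ea2 Aa.
- by apply: (mulfI bn); rewrite -eb2 Ab.
Qed.

End Trajectory.

(** * From the determinants back to A and B *)

Section CayleyConverse.
Context {R : realType}.
Variables (a b beta : R) (n : nat).
Hypotheses (b_gt0 : 0 < b) (ba : b < a) (beta_gt0 : 0 < beta) (n_gt0 : (0 < n)%N).

Let a_gt0 : 0 < a. Proof. exact: lt_trans ba. Qed.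

Lemma cayley_pell_even : ~~ odd n ->
  \det (hankel (taylor_B a b beta) 3 (n %/ 2 - 1)) = 0 ->
  exists A B : {poly R}, [/\ 'X^(2 * n) %| A + B * taylor_B_poly a b beta (2 * n),
    (size (A - 'X^n)%R <= n)%N, (size B <= n.-1)%N, A.[a] = a ^+ n & A.[b] = (- b) ^+ n].
Proof.
move=> ne.
have en : n = (2 * (n %/ 2 - 1) + 3 - 1)%N.
  rewrite divn2; have := odd_double_half n; rewrite (negbTE ne); move: n_gt0 (n./2).
  by clear; lia.
case/(hankel_det_eq0 (p := taylor_B_poly a b beta (2 * n))) => //.
  move=> k kn; rewrite coef_poly ifT//; move: kn n_gt0 en; clear; lia.
move=> Q [Q0 sQ kQ].
have size_f : size (cayley_cubic a b beta) = 4.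
  by rewrite /cayley_cubic !size_mul ?mulf_neq0 -?size_poly_eq0 ?size_CsubX.
have f_0 : 0 < (cayley_cubic a b beta).[0].
  by rewrite /cayley_cubic !hornerE !mulr_gt0 ?subr0.
have one_0 : 0 < (1 : {poly R}).[0] by rewrite hornerE.
have fw : 'X^(2 * n) %| cayley_cubic a b beta * 1 - taylor_B_poly a b beta (2 * n) ^+ 2.
  by rewrite mulr1; exact: taylor_B_sqr.
have eta : 'X^(2 * n) %| 1 * taylor_B_poly a b beta (2 * n) -
    taylor_B_poly a b beta (2 * n).
  by rewrite mul1r subrr dvdp0.
have [A [B [h1 h2 h3 h4 _]]] := pell_of_cayley n_gt0 en (erefl : 3 + 0 = 3)%N
  size_f (size_poly1 R) f_0 one_0 fw eta Q0 sQ kQ.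
exists A, B; split=> //.
  apply/eqP; rewrite -subr_eq0 -hornerXn -hornerN -hornerD -dvd_CsubX.
  by apply: dvdp_trans h4; rewrite /cayley_cubic -mulrA dvdp_mulIl.
apply/eqP; rewrite exprNn -signr_odd (negbTE ne) mul1r.
rewrite -subr_eq0 -hornerXn -hornerN -hornerD -dvd_CsubX.
by apply: dvdp_trans h4; rewrite /cayley_cubic -mulrA dvdp_mull// dvdp_mulIl.
Qed.

(** Here f2 = b - X divides A + X^n, so A(b) = -b^n, which is (-b)^n for odd n. *)
Lemma cayley_pell_odd : odd n ->
  \det (hankel (taylor_C a b beta) 2 ((n - 1) %/ 2)) = 0 ->
  exists A B : {poly R}, [/\ 'X^(2 * n) %| A + B * taylor_B_poly a b beta (2 * n),
    (size (A - 'X^n)%R <= n)%N, (size B <= n.-1)%N, A.[a] = a ^+ n & A.[b] = (- b) ^+ n].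
Proof.
move=> no.
have en : n = (2 * ((n - 1) %/ 2) + 2 - 1)%N.
  have := odd_double_half n; rewrite no; move: (n./2) => k; clear; lia.
case/(hankel_det_eq0 (p := taylor_C_poly a b beta (2 * n))) => //.
  move=> k kn; rewrite coef_poly ifT//; move: kn n_gt0 en; clear; lia.
move=> Q [Q0 sQ kQ].
have size_f1 : size ((a%:P - 'X) * (beta%:P - 'X)) = 3.
  by rewrite size_mul -?size_poly_eq0 ?size_CsubX.
have f1_0 : 0 < ((a%:P - 'X) * (beta%:P - 'X)).[0].
  by rewrite !hornerE !mulr_gt0 ?subr0.
have f2_0 : 0 < (b%:P - 'X).[0] by rewrite !hornerE subr0.
have fw : 'X^(2 * n) %| (a%:P - 'X) * (beta%:P - 'X) * (b%:P - 'X) -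
    taylor_B_poly a b beta (2 * n) ^+ 2.
  by rewrite mulrAC; exact: taylor_B_sqr.
have eta : 'X^(2 * n) %| (b%:P - 'X) * taylor_C_poly a b beta (2 * n) -
    taylor_B_poly a b beta (2 * n) by exact: taylor_C_mul.
have [A [B [h1 h2 h3 h4 h5]]] := pell_of_cayley n_gt0 en (erefl : 2 + 1 = 3)%N
  size_f1 (size_CsubX b) f1_0 f2_0 fw eta Q0 sQ kQ.
exists A, B; split=> //.
  apply/eqP; rewrite -subr_eq0 -hornerXn -hornerN -hornerD -dvd_CsubX.
  by apply: dvdp_trans h4; rewrite dvdp_mulIl.
apply/eqP; rewrite exprNn -signr_odd no mulN1r -addr_eq0 -hornerXn -hornerD.
by rewrite -dvd_CsubX.
Qed.

End CayleyConverse.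

Theorem corollary3p7 (R : realType) (a b beta : R) (P v : nat -> 'rV[R]_2)
    (n : nat) (hb : 0 < b) (hab : b < a)
    (htraj : magic_trajectory a b P v)
    (hbeta : nondegenerate_caustic a b beta)
    (hcaustic : has_caustic a b beta P v)
    (hn : (0 < n)%N) :
  n_periodic n P v <->
  (~~ odd n /\ \det (hankel (taylor_B a b beta) 3 (n %/ 2 - 1)) = 0)
  \/
  [/\ odd n, confocal_is_hyperbola a b beta &
      \det (hankel (taylor_C a b beta) 2 ((n - 1) %/ 2)) = 0].
Proof.
have ha : 0 < a by exact: lt_trans hab.
have step k : exists tmu : R * R,
    step_relation a b tmu.1 tmu.2 (P k) (v k) (P k.+1) (v k.+1).
  have [cP _ st] := htraj k.
  by have [[t [mu h]] _] := magic_stepP ha hb cP st; exists (t, mu).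
have V_lt0 k : (lax_V a b (P k) (v k)).[0] < 0.
  by have [cP _ st] := htraj k; have [] := magic_stepP ha hb cP st.
have [tmu rel] := choice step.
have onE k : confocal a b 0 (P k) by case: (htraj k).
have unit_v k : dot (v k) (v k) = 1 by case: (htraj k).
have [beta_gt0 _ _] := nondegenerate_caustic_neq hb hab hbeta.
split.
  move/(pell_of_periodic hb hab hbeta hn hcaustic onE unit_v rel V_lt0).
  case=> A [B [pell A0 sA Aa Ab]].
  have [no|ne] := boolP (odd n); [right|left]; split=> //.
  - exact: forward_hyperbola pell A0 sA Aa Ab no.
  - exact: forward_odd pell A0 sA Aa Ab no.
  - exact: forward_even pell A0 sA Aa Ab ne.
move=> H; suff [A [B [h1 h2 h3 h4 h5]]] : exists A B : {poly R},
    [/\ 'X^(2 * n) %| A + B * taylor_B_poly a b beta (2 * n),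
    (size (A - 'X^n)%R <= n)%N, (size B <= n.-1)%N, A.[a] = a ^+ n & A.[b] = (- b) ^+ n].
  exact: (periodic_of_pell hb hab hbeta hn hcaustic onE unit_v rel V_lt0 h1).
case: H => [[ne h]|[no _ h]]; first exact: cayley_pell_even h.
exact: cayley_pell_odd h.
Qed.
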